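(* Let $(X,d)$ be a Polish metric space, $1<p<\infty$, $E:\mathcal P_p(X)\to(-\infty,+\infty]$ proper and $G:\mathcal P_p(X)\to[0,+\infty]$ a weak upper gradient for $E$. Assume $E$ and $G$ have extensions $\tilde E:\mathcal P(X)\to(-\infty,+\infty]$, $\tilde G:\mathcal P(X)\to[0,+\infty]$ (agreeing with $E,G$ on $\mathcal P_p(X)$) satisfying (B1), (B3) and either (B2) or (B2'). Assume that for every $\rho_0\in Z_{E,p}$ there exists a $p$-curve of maximal slope $\rho\in AC([0,\infty);\mathcal P_p(X))$ of $E$ with respect to $G$ with $\rho(0)=\rho_0$. Then for any such curve, $$\lim_{t\to\infty}d_{LP}(\rho(t),\mathcal E_w)=\lim_{t\to\infty}\inf_{\mu\in\mathcal E_w}d_{LP}(\rho(t),\mu)=0.$$ Furthermore, if (B2') is satisfied with a set $\mathcal Y$ closed in $\mathcal P(X)$, then $\lim_{t\to\infty}d_{LP}(\rho(t),\mathcal E_w\cap\mathcal Y)=0$.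
   Context: $\mathcal P(X)$: Borel probability measures on $X$ with the narrow topology, metrised by the Lévy–Prokhorov metric $d_{LP}$. $\mathcal P_p(X)$: measures with finite $p$-th moment, with the $p$-Wasserstein distance $W_p$. $q=p/(p-1)$. $\rho\in AC([0,\infty);\mathcal P_p(X))$ means: for each $T>0$ there is $m\in L^1([0,T])$ with $W_p(\rho(t),\rho(s))\le\int_s^tm$ for $0\le s<t\le T$; metric derivative $|\rho'|(t)=\lim_{s\to t}W_p(\rho(t),\rho(s))/|t-s|$ (exists a.e.). $G$ is a weak upper gradient for $E$ if for every absolutely continuous curve $\rho$ on $[0,T]$ with $(G\circ\rho)|\rho'|\in L^1([0,T])$, $E\circ\rho$ is a.e. equal to a function $\varphi$ of finite pointwise variation with $|\varphi'|\le G(\rho)|\rho'|$ a.e. A $p$-curve of maximal slope for $E$ w.r.t. $G$ is $\rho\in AC([0,\infty);\mathcal P_p(X))$ with $E\circ\rho$ a.e. equal to a non-increasing $\varphi$ satisfying $\varphi'(t)=-\frac1p|\rho'|^p(t)-\frac1qG^q(\rho(t))$ for a.e. $t$. $Z_{E,p}=\{\rho\in\mathcal P_p(X):E(\rho)<\infty\}$. A weak stationary state is $\mu\in\mathcal P(X)$ with $\tilde E(\mu)<\infty$ and $\tilde G(\mu)=0$; $\mathcal E_w$ is their set. $d_{LP}(\mu,A)=\inf_{\nu\in A}d_{LP}(\mu,\nu)$. (B1) $\tilde E$ proper, bounded below, l.s.c. on $\mathcal P(X)$. (B2) For every $C\in\mathbb R$, $\{\mu\in\mathcal P(X):\tilde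 E(\mu)\le C\}$ is relatively compact in $\mathcal P(X)$. (B2') There is $\mathcal Y\subset\mathcal P(X)$ containing $\rho(t)$ for all $t\ge0$ such that $\{\mu\in\mathcal P_p(X)\cap\mathcal Y:E(\mu)\le C\}$ is relatively compact in $\mathcal P(X)$ for every $C$. (B3) $\tilde G$ l.s.c. on $\mathcal P(X)$. *)

(* Defs.v *)
From HB Require Import structures.
From mathcomp Require Import all_boot all_order all_algebra.
From mathcomp Require Import all_classical all_reals all_analysis.
Set Implicit Arguments. Unset Strict Implicit. Unset Printing Implicit Defensive.
Import Order.TTheory GRing.Theory Num.Theory.
Import numFieldNormedType.Exports.
Local Open Scope classical_set_scope.
Local Open Scope ring_scope.

Section Defs.
Context {R : realType} {dX : measure_display} {X : measurableType dX}.
Variable dist : X -> X -> R.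

Definition is_metric : Prop :=
  (forall x y, 0 <= dist x y) /\ (forall x y, dist x y = 0 <-> x = y) /\
  (forall x y, dist x y = dist y x) /\
  (forall x y z, dist x z <= dist x y + dist y z).

Definition dball (x : X) (e : R) : set X := [set y | dist x y < e].

Definition d_open (A : set X) : Prop :=
  forall x, A x -> exists2 e : R, 0 < e & dball x e `<=` A.

Definition d_cvg (u : nat -> X) (x : X) : Prop :=
  (fun n => dist (u n) x) @ \oo --> (0 : R).

Definition d_complete : Prop :=
  forall u : nat -> X,
    (forall e : R, 0 < e -> exists N, forall n m, (N <= n)%N -> (N <= m)%N ->
       dist (u n) (u m) < e) ->
    exists x, d_cvg u x.

Definition d_separable : Prop :=
  exists s : nat -> X, forall x (e : R), 0 < e -> exists n, dist x (s n) < e.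

Definition polish_borel : Prop :=
  [/\ is_metric, d_complete, d_separable &
      (@measurable _ X) = <<s d_open >>].

Definition PX := probability X R.

Definition Pp (p : R) (mu : PX) : Prop :=
  exists x0 : X, (\int[mu]_x ((dist x0 x) `^ p)%:E < +oo)%E.

Definition coupling (mu nu : PX) (g : probability (X * X)%type R) : Prop :=
  forall A : set X, measurable A ->
    g (A `*` setT) = mu A /\ g (setT `*` A) = nu A.

Definition Wp (p : R) (mu nu : PX) : R :=
  (fine (ereal_inf [set (\int[g]_z ((dist z.1 z.2) `^ p)%:E)%E
                   | g in coupling mu nu])) `^ p^-1.

Definition enlarge (A : set X) (e : R) : set X :=
  [set x | exists2 a, A a & dist x a < e].

Definition dLP (mu nu : PX) : R :=
  inf [set e : R | 0 < e /\ forall A : set X, measurable A ->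
        (mu A <= nu (enlarge A e) + e%:E)%E /\ (nu A <= mu (enlarge A e) + e%:E)%E].

(* d_LP(mu, A) = inf_{nu in A} d_LP(mu, nu)  (= +oo if A is empty) *)
Definition dLP_set (mu : PX) (A : set PX) : \bar R :=
  ereal_inf [set (dLP mu nu)%:E | nu in A].

(* narrow topology (metrised by d_LP): sequential notions *)
Definition LP_cvg (u : nat -> PX) (mu : PX) : Prop :=
  (fun n => dLP (u n) mu) @ \oo --> (0 : R).

Definition LP_lsc (F : PX -> \bar R) : Prop :=
  forall (u : nat -> PX) (mu : PX), LP_cvg u mu -> (F mu <= limn_einf (F \o u))%E.

Definition LP_rel_compact (S : set PX) : Prop :=
  forall u : nat -> PX, (forall n, S (u n)) ->
    exists (f : nat -> nat) (mu : PX),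
      (forall n, (f n < f n.+1)%N) /\ LP_cvg (u \o f) mu.

Definition LP_closed (S : set PX) : Prop :=
  forall (u : nat -> PX) (mu : PX), (forall n, S (u n)) -> LP_cvg u mu -> S mu.

Local Notation leb := (@lebesgue_measure R).

Definition AC_on (p T : R) (rho : R -> PX) : Prop :=
  (forall t, 0 <= t <= T -> Pp p (rho t)) /\
  exists m : R -> R, leb.-integrable `[0, T] (EFin \o m) /\
    forall s t, 0 <= s -> s < t -> t <= T ->
      ((Wp p (rho t) (rho s))%:E <= \int[leb]_(x in `[s, t]) (m x)%:E)%E.

Definition AC_inf (p : R) (rho : R -> PX) : Prop :=
  forall T, 0 < T -> AC_on p T rho.

Definition metric_deriv (p : R) (rho : R -> PX) (t : R) : R :=
  lim ((fun s => Wp p (rho t) (rho s) / `|t - s|) @ t^').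

Definition weak_upper_gradient (p : R) (E G : PX -> \bar R) : Prop :=
  forall (T : R) (rho : R -> PX), 0 < T -> AC_on p T rho ->
    leb.-integrable `[0, T] (fun t => (G (rho t) * (metric_deriv p rho t)%:E)%E) ->
    exists phi : R -> R,
      [/\ {ae leb, forall t, t \in `[0, T] -> E (rho t) = (phi t)%:E},
          bounded_variation 0 T phi &
          {ae leb, forall t, t \in `[0, T] ->
             derivable phi t 1 /\
             ((`|derive1 phi t|)%:E <= G (rho t) * (metric_deriv p rho t)%:E)%E}].

Definition max_slope_curve (p : R) (E G : PX -> \bar R) (rho : R -> PX) : Prop :=
  AC_inf p rho /\
  exists phi : R -> R,
    [/\ {in `[0, +oo[ &, {homo phi : s t /~ s <= t}},
        {ae leb, forall t, t \in `[0, +oo[ -> E (rho t) = (phi t)%:E} &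
        {ae leb, forall t, t \in `[0, +oo[ ->
           derivable phi t 1 /\
           (derive1 phi t)%:E = (- (p^-1 * (metric_deriv p rho t) `^ p)%:E
                             - (p / (p - 1))^-1%:E * poweR (G (rho t)) (p / (p - 1)))%E}].

Definition Z_Ep (p : R) (E : PX -> \bar R) : set PX :=
  [set mu | Pp p mu /\ (E mu < +oo)%E].

Definition weak_stationary (Et Gt : PX -> \bar R) : set PX :=
  [set mu | (Et mu < +oo)%E /\ Gt mu = 0%E].

Definition B1 (Et : PX -> \bar R) : Prop :=
  [/\ (forall mu, Et mu != -oo%E), (exists mu, Et mu < +oo)%E,
      (exists c : R, forall mu, (c%:E <= Et mu)%E) & LP_lsc Et].

Definition B2 (Et : PX -> \bar R) : Prop :=
  forall C : R, LP_rel_compact [set mu | (Et mu <= C%:E)%E].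

Definition B2' (p : R) (E : PX -> \bar R) (rho : R -> PX) (Y : set PX) : Prop :=
  (forall t, 0 <= t -> Y (rho t)) /\
  forall C : R, LP_rel_compact [set mu | Pp p mu /\ Y mu /\ (E mu <= C%:E)%E].

Definition B3 (Gt : PX -> \bar R) : Prop := LP_lsc Gt.

End Defs.

(* Main.v *)
Require Import Defs.
From HB Require Import structures.
From mathcomp Require Import all_boot all_order all_algebra.
From mathcomp Require Import all_classical all_reals all_analysis measurable_realfun.
From mathcomp Require Import ring lra.
Set Implicit Arguments. Unset Strict Implicit. Unset Printing Implicit Defensive.
Import Order.TTheory GRing.Theory Num.Theory.
Import numFieldNormedType.Exports.
Local Open Scope classical_set_scope.
Local Open Scope ring_scope.

(* Along a curve of maximal slope the energy is nonincreasing and bounded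
   below, so the energy dissipated on [[t, t + 2]] tends to [0] as [t] grows. It
   bounds the integrals of [G ^ q] and of the [p]-th power of the metric
   derivative: there is a time [s] in [[t, t + 1]] at which [G] is small, while
   [W_p (rho t) (rho s)], hence the Levy-Prokhorov distance, is small too. By
   compactness and lower semicontinuity such [rho s] accumulate only at weak
   stationary states.

   Using the metric derivative requires its existence almost everywhere, hence
   the triangle inequality for [W_p]. Instead of disintegrating couplings, two
   couplings are glued along a countable partition of the middle space into
   sets of small diameter, which is exact on the marginals and moves the middle
   point by an arbitrarily small distance. *)

(** * Measurability on a Polish space *)

(** Two totalised definitions shape the proof. [metric_deriv] is a [lim], which says nothing until
    convergence is known; [Wp] takes [fine] of an infimum, so an infinite optimal cost would read as
    [0], and the [Pp] hypotheses exclude this. The function [phi] of a curve of maximal slope is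
    only monotone: its derivative may miss part of the drop, so no energy identity is available. The
    one-sided bound of the integral of [- phi'] by the drop survives, and it suffices. It comes from
    difference quotients that look ahead by at most [1], which explains why the drop on [[t, t + 2]]
    controls integrals on [[t, t + 1]]. An integral bound makes [G] small at some time [s] near [t],
    not at [t] itself. The bound on [W_p (rho t) (rho s)] carries the conclusion back to every large
    [t], so that the limit is not merely along a sequence of times. *)

Section polish_space.
Context {R : realType} {dX : measure_display} {X : measurableType dX}.
Context {dist : X -> X -> R} (Pd : polish_borel dist).

Lemma dist_ge0 x y : 0 <= dist x y.
Proof. by case: Pd => -[+ _] _ _ _; apply. Qed.

Lemma distxx x : dist x x = 0.
Proof. by case: Pd => -[_ [d0 _]] _ _ _; apply/d0. Qed.

Lemma dist_sym x y : dist x y = dist y x.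
Proof. by case: Pd => -[_ [_ [+ _]]] _ _ _; apply. Qed.

Lemma dist_triangle y x z : dist x z <= dist x y + dist y z.
Proof. by case: Pd => -[_ [_ [_ +]]] _ _ _; apply. Qed.

Lemma measurable_d_open A : d_open dist A -> measurable A.
Proof. by case: Pd => _ _ _ mE oA; rewrite mE; exact: sub_sigma_algebra. Qed.

Lemma d_open_dball x e : d_open dist (dball dist x e).
Proof.
move=> y; rewrite /dball/= => xy.
exists (e - dist x y); first by rewrite subr_gt0.
by move=> z /= yz; rewrite (le_lt_trans (dist_triangle y _ _))// -ltrBrDl.
Qed.

Lemma d_open_enlarge A e : d_open dist (enlarge dist A e).
Proof.
move=> x [a Aa xa]; exists (e - dist x a); first by rewrite subr_gt0.
move=> y /= xy; exists a => //.
by rewrite (le_lt_trans (dist_triangle x _ _))// -ltrBrDr dist_sym.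
Qed.

Lemma measurable_dball x e : measurable (dball dist x e).
Proof. exact/measurable_d_open/d_open_dball. Qed.

Lemma measurable_enlarge A e : measurable (enlarge dist A e).
Proof. exact/measurable_d_open/d_open_enlarge. Qed.

Lemma measurable_distl x : measurable_fun setT (dist x).
Proof.
apply: (measurability _ (RGenInftyO.measurableE R)) => _ [_ [r ->] <-].
rewrite setTI (_ : _ @^-1` _ = dball dist x r); first exact: measurable_dball.
by apply/seteqP; split => y /=; rewrite in_itv.
Qed.

(** Separability enters here, since the sigma-algebra on [X * X] is the product one: [dist x y < r]
    holds exactly when [dist (s n) x + dist (s n) y < r] for some point [s n] of a dense
    sequence. *)
Lemma measurable_dist : measurable_fun setT (fun z : X * X => dist z.1 z.2).
Proof.
have [s sd] : d_separable dist by case: Pd.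
pose h n (z : X * X) := dist (s n) z.1 + dist (s n) z.2.
have mh n : measurable_fun setT (h n).
  by apply: measurable_funD; apply: measurableT_comp => //; exact: measurable_distl.
apply: (measurability _ (RGenInftyO.measurableE R)) => _ [_ [r ->] <-].
rewrite setTI (_ : _ @^-1` _ = \bigcup_n (setT `&` h n @^-1` `]-oo, r[)).
  by apply: bigcup_measurable => n _; apply: mh => //; exact: measurable_itv.
apply/seteqP; split => [[x y]|[x y] [n _ [_]]] /=; rewrite !in_itv/=.
  move=> xyr; have [|n xn] := sd x ((r - dist x y) / 2).
    by rewrite divr_gt0// subr_gt0.
  exists n => //; split => //=; rewrite in_itv/=.
  have := dist_triangle x (s n) y; rewrite /h/= (dist_sym (s n) x).
  move: xn xyr; lra.
by move=> hr; rewrite (le_lt_trans (dist_triangle (s n) x y))// dist_sym.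
Qed.

End polish_space.

(** The marginals of couplings and of glued measures are known only through their values on
    measurable sets; this form changes variables from that information alone. *)
Lemma ge0_integral_marginal d1 d2 (T1 : measurableType d1)
    (T2 : measurableType d2) (R : realType) (P : {measure set T1 -> \bar R})
    (Q : {measure set T2 -> \bar R}) (h : T1 -> T2) (f : T2 -> \bar R) :
  measurable_fun setT h ->
  (forall A, measurable A -> P (h @^-1` A) = Q A) ->
  measurable_fun setT f -> (forall x, (0 <= f x)%E) ->
  (\int[P]_x f (h x) = \int[Q]_y f y)%E.
Proof.
move=> mh PQ mf f0.
have := @ge0_integral_pushforward _ _ _ _ _ _ mh P setT f measurableT mf
  (fun y _ => f0 y).
rewrite preimage_setT => <-.
by apply: eq_measure_integral => A mA _; exact: PQ.
Qed.

(** * Minkowski's inequality for real-valued functions *)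

Section Lnorm.
Context {d} {T : measurableType d} {R : realType}.
Implicit Types (mu : {measure set T -> \bar R}) (f g : T -> R) (p : R).

Lemma measurable_powR_comp f p : measurable_fun setT f ->
  measurable_fun setT (fun x => f x `^ p).
Proof. by move=> mf; exact: (measurableT_comp (measurable_powR p)). Qed.

Lemma Lnorm_powR mu f p : p != 0 -> (forall x, 0 <= f x) ->
  (\int[mu]_x (f x `^ p)%:E = ('N[mu]_p%:E[EFin \o f] `^ p))%E.
Proof.
move=> p0 f0; rewrite (poweR_Lnorm mu _ p0).
by apply: eq_integral => x _ /=; rewrite ger0_norm.
Qed.

Lemma ae_ge0_le_Lnorm mu f g p : 0 < p ->
  measurable_fun setT f -> measurable_fun setT g ->
  (forall x, 0 <= f x) -> (forall x, 0 <= g x) ->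
  {ae mu, forall x, f x <= g x} ->
  ('N[mu]_p%:E[EFin \o f] <= 'N[mu]_p%:E[EFin \o g])%E.
Proof.
move=> p0 mf mg f0 g0 fg; rewrite unlock.
have i0 h : (0 <= \int[mu]_x `|(EFin \o h) x| `^ p)%E.
  by apply: integral_ge0 => x _; exact: poweR_ge0.
apply: gt0_ler_poweR; rewrite ?in_itv/= ?leey ?i0 ?invr_ge0 ?(ltW p0)//.
rewrite /=; apply: (ae_ge0_le_integral measurableT) => //=.
- by apply/measurable_EFinP/measurable_powR_comp/measurableT_comp.
- by apply/measurable_EFinP/measurable_powR_comp/measurableT_comp.
- apply: filterS fg => x fg _; rewrite lee_fin !ger0_norm//.
  by apply: ge0_ler_powR; rewrite ?nnegrE ?(ltW p0).
Qed.

(** Three terms, because both uses pass through two intermediate points; almost everywhere, because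
    the glued measure controls its middle leg only in that sense. *)
Lemma Lnorm_triangle3 mu f f1 f2 f3 p : 1 <= p ->
  measurable_fun setT f -> measurable_fun setT f1 -> measurable_fun setT f2 ->
  measurable_fun setT f3 ->
  (forall x, 0 <= f x) -> {ae mu, forall x, f x <= f1 x + f2 x + f3 x} ->
  ('N[mu]_p%:E[EFin \o f] <= 'N[mu]_p%:E[EFin \o f1] + 'N[mu]_p%:E[EFin \o f2]
     + 'N[mu]_p%:E[EFin \o f3])%E.
Proof.
move=> p1 mf mf1 mf2 mf3 f0 ff.
have p0 : 0 < p by rewrite (lt_le_trans _ p1).
apply: (@le_trans _ _ ('N[mu]_p%:E[EFin \o (fun x => `|f1 x + f2 x + f3 x|)%R])%E).
  apply: ae_ge0_le_Lnorm => //.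
  - apply: measurableT_comp => //; apply: measurable_funD => //.
    exact: measurable_funD.
  - by apply: filterS ff => x /le_trans; apply; exact: ler_norm.
rewrite (_ : EFin \o _ = abse \o (EFin \o (f1 \+ f2 \+ f3)))// Lnorm_abse.
have /= := minkowski_EFin mu (measurable_funD mf1 mf2) mf3 p1.
move=> /le_trans; apply; rewrite leeD2r//.
exact: (minkowski_EFin mu mf1 mf2).
Qed.

End Lnorm.

(** * The Wasserstein distance *)

Section wasserstein.
Context {R : realType} {dX : measure_display} {X : measurableType dX}.
Context {dist : X -> X -> R} (Pd : polish_borel dist) {p : R} (p1 : 1 < p).
Implicit Types (mu nu : probability X R) (g : probability (X * X)%type R) (c : R).

Local Notation cost g := (\int[g]_z (dist z.1 z.2 `^ p)%:E)%E.
Local Notation W := (Wp dist p).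

Let p_gt0 : 0 < p. Proof. exact: lt_trans p1. Qed.
Let p_neq0 : p != 0. Proof. exact: lt0r_neq0. Qed.

Lemma Wp_ge0 mu nu : 0 <= W mu nu.
Proof. exact: powR_ge0. Qed.

Lemma cost_ge0 g : (0 <= cost g)%E.
Proof. by apply: integral_ge0 => z _; rewrite lee_fin powR_ge0. Qed.

Lemma ereal_inf_cost_ge0 mu nu :
  (0 <= ereal_inf [set cost g | g in coupling mu nu])%E.
Proof. by apply: le_ereal_inf_tmp => _ [g _ <-]; exact: cost_ge0. Qed.

Lemma Wp_le mu nu g c : coupling mu nu g -> 0 <= c ->
  (cost g <= (c `^ p)%:E)%E -> W mu nu <= c.
Proof.
move=> cg c0 gc; rewrite /Wp; have := ereal_inf_cost_ge0 mu nu.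
set I := ereal_inf _ => I0.
have Ic : (I <= (c `^ p)%:E)%E.
  by apply: le_trans gc; apply: ereal_inf_lbound; exists g.
have fI : fine I <= c `^ p.
  by rewrite -lee_fin fineK// ge0_fin_numE// (le_lt_trans Ic)// ltry.
rewrite -[leRHS]powRr1// -(mulfV p_neq0) powRrM.
by apply: ge0_ler_powR; rewrite ?nnegrE ?fine_ge0 ?powR_ge0// invr_ge0 ltW.
Qed.

(** The law of [(h1, h2)] is a coupling, so upper bounds on [Wp] can be computed on any probability
    space: the diagonal, a swap, or the four-point space of the gluing. *)
Lemma Wp_le_image d (T : measurableType d) (P : probability T R)
    (h1 h2 : T -> X) mu nu c :
  measurable_fun setT h1 -> measurable_fun setT h2 ->
  (forall A, measurable A -> P (h1 @^-1` A) = mu A) ->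
  (forall A, measurable A -> P (h2 @^-1` A) = nu A) ->
  0 <= c -> (\int[P]_x (dist (h1 x) (h2 x) `^ p)%:E <= (c `^ p)%:E)%E ->
  W mu nu <= c.
Proof.
move=> mh1 mh2 P1 P2 c0 Pc.
have mh : measurable_fun setT (fun x => (h1 x, h2 x)).
  exact: measurable_fun_pair.
pose h : {mfun T >-> (X * X)%type} :=
  HB.pack (fun x => (h1 x, h2 x)) (isMeasurableFun.Build _ _ _ _ _ mh).
pose g : probability (X * X)%type R := distribution P h.
apply: (@Wp_le _ _ g) => //.
  move=> A mA; rewrite /g/= /distribution/= /pushforward/= -P1// -P2//.
  by split; congr (P _); apply/seteqP; split => x /=; [case|split|case|split].
rewrite ge0_integral_distribution//.
  apply/measurable_EFinP/measurable_powR_comp; exact: measurable_dist.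
by move=> z; rewrite lee_fin powR_ge0.
Qed.

Lemma measurable_cost : measurable_fun setT
  (fun z : X * X => (dist z.1 z.2 `^ p)%:E).
Proof.
by apply/measurable_EFinP/measurable_powR_comp; exact: measurable_dist.
Qed.

Lemma Wp_xx mu : W mu mu = 0.
Proof.
apply/eqP; rewrite eq_le Wp_ge0 andbT.
apply: (@Wp_le_image _ X mu id id) => //.
under eq_integral do rewrite distxx//.
by rewrite powR0// integral0.
Qed.

(** The product measure works: going through the base points [x0] and [y0], Minkowski bounds its
    cost by the two moments and a constant. *)
Lemma Wp_finite_coupling mu nu : Pp dist p mu -> Pp dist p nu ->
  exists2 g, coupling mu nu g & (cost g < +oo)%E.
Proof.
move=> [x0 mu0] [y0 nu0].
pose P : probability (X * X)%type R := (mu \x nu)%E.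
have Pf A : measurable A -> P (fst @^-1` A) = mu A.
  move=> mA; rewrite (_ : _ @^-1` _ = A `*` setT); last first.
    by apply/seteqP; split => x //= [].
  transitivity (mu A * nu setT)%E; first exact: product_measure1E.
  by rewrite probability_setT mule1.
have Ps A : measurable A -> P (snd @^-1` A) = nu A.
  move=> mA; rewrite (_ : _ @^-1` _ = setT `*` A); last first.
    by apply/seteqP; split => x //= [].
  transitivity (mu setT * nu A)%E; first exact: product_measure1E.
  by rewrite probability_setT mul1e.
exists P.
  move=> A mA; rewrite -Pf// -Ps//.
  by split; congr (P _); apply/seteqP; split => x //= [].
rewrite Lnorm_powR//; last by move=> z; exact: dist_ge0.
apply: poweR_lty.
have mf1 : measurable_fun setT (fun z : X * X => dist x0 z.1).
  by apply: (measurableT_comp (measurable_distl Pd x0)).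
have mf3 : measurable_fun setT (fun z : X * X => dist y0 z.2).
  by apply: (measurableT_comp (measurable_distl Pd y0)).
have mf2 : measurable_fun setT (fun _ : X * X => dist x0 y0) by [].
apply: (@le_lt_trans _ _ _ _ _
  (Lnorm_triangle3 (ltW p1) (measurable_dist Pd) mf1 mf2 mf3 _ _)).
- by move=> z; exact: dist_ge0.
- apply: aeW => z; rewrite (le_trans (dist_triangle Pd y0 _ _))// lerD2r.
  by rewrite (le_trans (dist_triangle Pd x0 _ _))// (dist_sym Pd z.1).
have fin (f : X -> R) (Q : probability X R) (h : X * X -> X) :
    measurable_fun setT h ->
    (forall A, measurable A -> P (h @^-1` A) = Q A) ->
    measurable_fun setT f -> (forall x, 0 <= f x) ->
    (\int[Q]_x (f x `^ p)%:E < +oo)%E ->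
    ('N[P]_p%:E[EFin \o (fun z => f (h z))] < +oo)%E.
  move=> mh PQ mf f0 ff; apply: (@lty_poweRy _ _ p) => //.
  rewrite -Lnorm_powR//.
  rewrite (ge0_integral_marginal mh PQ (f := fun x => (f x `^ p)%:E))//.
    exact/measurable_EFinP/measurable_powR_comp.
  by move=> x; rewrite lee_fin powR_ge0.
rewrite !lte_add_pinfty//.
- apply: (fin _ mu fst) => //; first exact: measurable_distl.
  by move=> x; exact: dist_ge0.
- apply: (@lty_poweRy _ _ p) => //; rewrite -Lnorm_powR//; last first.
    by move=> x; exact: dist_ge0.
  rewrite integral_cst// lte_mul_pinfty ?lee_fin ?powR_ge0//.
  exact: (le_lt_trans (probability_le1 P measurableT) (ltry _)).
- apply: (fin _ nu snd) => //; first exact: measurable_distl.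
  by move=> x; exact: dist_ge0.
Qed.

(** Converse to [Wp_le]. Finite moments keep the infimum finite, so that [fine] loses nothing. *)
Lemma Wp_lt_coupling mu nu c : Pp dist p mu -> Pp dist p nu ->
  W mu nu < c -> exists2 g, coupling mu nu g & (cost g < (c `^ p)%:E)%E.
Proof.
move=> Pmu Pnu Wc; have [g0 cg0 fg0] := Wp_finite_coupling Pmu Pnu.
have c0 : 0 < c by rewrite (le_lt_trans _ Wc)// Wp_ge0.
move: Wc; rewrite /Wp; have := ereal_inf_cost_ge0 mu nu.
set I := ereal_inf _ => I0 Ic.
have If : I \is a fin_num.
  by rewrite ge0_fin_numE// (le_lt_trans _ fg0)// ereal_inf_lbound//; exists g0.
have : (I < (c `^ p)%:E)%E.
  rewrite -(fineK If) lte_fin -[ltLHS]powRr1 ?fine_ge0//.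
  rewrite -(mulVf p_neq0) powRrM.
  by apply: gt0_ltr_powR; rewrite ?nnegrE ?powR_ge0// ltW.
by move=> /ereal_inf_lt[_ [g cg <-] gc]; exists g.
Qed.

Lemma Wp_sym_le mu nu : Pp dist p mu -> Pp dist p nu -> W mu nu <= W nu mu.
Proof.
move=> Pmu Pnu; apply/ler_addgt0Pr => e e0.
have [g cg gc] : exists2 g, coupling nu mu g &
    (cost g < ((W nu mu + e) `^ p)%:E)%E.
  by apply: Wp_lt_coupling => //; rewrite ltrDl.
apply: (Wp_le_image measurable_snd measurable_fst (P := g)).
- by move=> A mA; rewrite -(cg A mA).2; congr (g _); apply/seteqP; split => x //= [].
- by move=> A mA; rewrite -(cg A mA).1; congr (g _); apply/seteqP; split => x //= [].
- by rewrite addr_ge0 ?Wp_ge0// ltW.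
- rewrite (eq_integral (fun z => (dist z.1 z.2 `^ p)%:E)); first exact: ltW.
  by move=> z _; rewrite (dist_sym Pd).
Qed.

Lemma Wp_sym mu nu : Pp dist p mu -> Pp dist p nu -> W mu nu = W nu mu.
Proof. by move=> Pmu Pnu; apply/eqP; rewrite eq_le !Wp_sym_le. Qed.

End wasserstein.

(** * Approximate gluing and the triangle inequality for [Wp] *)

Section gluing.
Context {R : realType} {dX : measure_display} {X : measurableType dX}.
Context {dist : X -> X -> R} (Pd : polish_borel dist).

Lemma small_partition (e : R) : 0 < e -> exists B : (set X)^nat,
  [/\ forall i, measurable (B i), trivIset setT B, \bigcup_i B i = setT &
      forall i x y, B i x -> B i y -> dist x y <= e].
Proof.
move=> e0; have [s sd] : d_separable dist by case: Pd.
pose F n := dball dist (s n) (e / 2).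
exists (seqDU F); split.
- by apply: seqDU_measurable => n; exact: measurable_dball.
- exact: trivIset_seqDU.
- rewrite -seqDU_bigcup_eq; apply/seteqP; split => // x _.
  have [|n xn] := sd x (e / 2); first by rewrite divr_gt0.
  by exists n => //; rewrite /F /dball/= (dist_sym Pd).
- move=> i x y xi yi.
  have := @subset_seqDU _ F i _ xi; rewrite /F /dball/= => ix.
  have := @subset_seqDU _ F i _ yi; rewrite /F /dball/= => iy.
  have := dist_triangle Pd (s i) x y; rewrite (dist_sym Pd x (s i)); lra.
Qed.

Lemma measure_partition d (T : measurableType d) (P : {measure set T -> \bar R})
    (F : (set T)^nat) (S : set T) :
  (forall i, measurable (F i)) -> trivIset setT F -> \bigcup_i F i = setT ->
  measurable S -> (\sum_(i <oo) P (S `&` F i) = P S)%E.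
Proof.
move=> mF tF FT mS; rewrite -[in RHS](setIT S) -FT setI_bigcupr.
rewrite measure_semi_bigcup//.
- by move=> i; exact: measurableI.
- exact: trivIset_setIl.
- by apply: bigcupT_measurable => i; exact: measurableI.
Qed.

Lemma mnormalize1E d (T : measurableType d) (m : {measure set T -> \bar R})
    (P : probability T R) A : m setT = 1%E -> mnormalize m P A = m A.
Proof. by move=> m1; rewrite /mnormalize m1 onee_eq0/= invr1 mule1. Qed.

(** [P] makes the two couplings independent conditionally on the cell of the middle point: it sums
    the restrictions of [g \x h] to [E i], where both middle points lie in [B i], divided by
    [nu (B i)]. In either marginal the other factor contributes exactly [nu (B i)], which cancels
    the weight. *)
Lemma approximate_gluing (mu nu la : probability X R)
    (g h : probability (X * X)%type R) (e : R) :
  coupling mu nu g -> coupling nu la h -> 0 < e ->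
  exists P : probability ((X * X) * (X * X))%type R,
    [/\ forall S, measurable S -> P (fst @^-1` S) = g S,
        forall S, measurable S -> P (snd @^-1` S) = h S &
        {ae P, forall z, dist z.1.2 z.2.1 <= e}].
Proof.
move=> cg ch /small_partition[B [mB tB BT Be]].
pose E i := ([set: X] `*` B i) `*` (B i `*` [set: X]).
have mE i : measurable (E i) by do 2 apply: measurableX => //.
have w0 i : 0 <= (fine (nu (B i)))^-1 by rewrite invr_ge0 fine_ge0.
pose m i := mscale (NngNum (w0 i)) (mrestr (g \x h)%E (mE i)).
pose G := mseries (fun i => m i) 0.
have ghE A C : measurable A -> measurable C ->
    ((g \x h) (A `*` C) = g A * h C)%E.
  by move=> mA mC; exact: product_measure1E.
(* On a null cell the inverse of [0] is [0], but [x <= nu (B i)] then forces [x = 0], and the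
   identity persists. *)
have nuw i x : (x <= nu (B i) -> 0 <= x ->
    (fine (nu (B i)))^-1%:E * (x * nu (B i)) = x)%E.
  move=> xnu x0; have nuf : nu (B i) \is a fin_num by exact: fin_num_measure.
  have [nu0|nu0] := eqVneq (nu (B i)) 0%E.
    have -> : x = 0%E by apply/eqP; rewrite eq_le x0 -nu0 xnu.
    by rewrite mul0e mule0.
  rewrite -{2}(fineK nuf) muleCA -EFinM mulVf ?mule1//.
  by rewrite fine_eq0.
have G1 S : measurable S -> G (fst @^-1` S) = g S.
  move=> mS; pose F i := [set: X] `*` B i.
  have mF i : measurable (F i) by exact: measurableX.
  rewrite -(@measure_partition _ _ g F S)//; last 2 first.
  - move=> i j _ _ [[x y] [[_ /= yi] [_ /= yj]]].
    by apply: tB => //; exists y.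
  - apply/seteqP; split => // -[x y] _.
    by have : setT y by []; rewrite -BT => -[i _ yi]; exists i.
  rewrite /G /mseries; apply: eq_eseriesr => i _.
  transitivity ((fine (nu (B i)))^-1%:E *
      (g \x h) ((S `&` F i) `*` (B i `*` setT)))%E; last first.
    rewrite ghE; [|exact: measurableI|exact: measurableX].
    rewrite (ch _ (mB i)).1 nuw//.
    rewrite -(cg _ (mB i)).2; apply: le_measure; rewrite ?inE.
    + exact: measurableI.
    + exact: measurableX.
    + by move=> z [].
  congr (_ * (g \x h) _)%E.
  by apply/seteqP; split => z /=; rewrite /E /F/=; tauto.
have G2 S : measurable S -> G (snd @^-1` S) = h S.
  move=> mS; pose F i := B i `*` [set: X].
  have mF i : measurable (F i) by exact: measurableX.
  rewrite -(@measure_partition _ _ h F S)//; last 2 first.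
  - move=> i j _ _ [[x y] [[/= xi _] [/= xj _]]].
    by apply: tB => //; exists x.
  - apply/seteqP; split => // -[x y] _.
    by have : setT x by []; rewrite -BT => -[i _ xi]; exists i.
  rewrite /G /mseries; apply: eq_eseriesr => i _.
  transitivity ((fine (nu (B i)))^-1%:E *
      (g \x h) ((setT `*` B i) `*` (S `&` F i)))%E; last first.
    rewrite ghE; [|exact: measurableX|exact: measurableI].
    rewrite (cg _ (mB i)).2 [X in (_ * X)%E]muleC nuw//.
    rewrite -(ch _ (mB i)).1; apply: le_measure; rewrite ?inE.
    + exact: measurableI.
    + exact: measurableX.
    + by move=> z [].
  congr (_ * (g \x h) _)%E.
  by apply/seteqP; split => z /=; rewrite /E /F/=; tauto.
have GT : G setT = 1%E by rewrite -(preimage_setT fst) G1// probability_setT.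
(* [G] already has mass one: normalising does not change it and only supplies the probability
   structure. *)
pose P : probability ((X * X) * (X * X))%type R := mnormalize G (g \x h)%E.
have PG A : P A = G A by exact: mnormalize1E.
exists P; split; first by move=> S mS; rewrite PG; exact: G1.
  by move=> S mS; rewrite PG; exact: G2.
have md : measurable_fun setT (fun z : (X * X) * (X * X) => dist z.1.2 z.2.1).
  have mh : measurable_fun setT (fun z : (X * X) * (X * X) => (z.1.2, z.2.1)).
    by apply: measurable_fun_pair; apply: measurableT_comp.
  exact: (measurableT_comp (measurable_dist Pd) mh).
exists [set z | e < dist z.1.2 z.2.1]; split.
- rewrite (_ : mkset _ = setT `&` (fun z : (X * X) * (X * X) =>
    dist z.1.2 z.2.1) @^-1` `]e, +oo[); first by apply: md; [|exact: measurable_itv].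
  by apply/seteqP; split => z /=; rewrite in_itv/= andbT => // -[].
- rewrite PG; apply: eseries0 => i _ _.
  transitivity ((fine (nu (B i)))^-1%:E * (g \x h) set0)%E; last first.
    by rewrite measure0 mule0.
  congr (_ * (g \x h) _)%E.
  apply/seteqP; split => // z /= [] + [[_ zi] [zi' _]].
  by rewrite ltNge (Be i).
- by move=> z /= /negP; rewrite -ltNge.
Qed.

Context {p : R} (p1 : 1 < p).
Local Notation W := (Wp dist p).

(** The path [z.1.1], [z.1.2], [z.2.1], [z.2.2] has three legs: two nearly optimal couplings and the
    jump between the two middle points. Each receives a third of the slack [e]. *)
Lemma Wp_triangle (nu mu la : probability X R) :
  Pp dist p mu -> Pp dist p nu -> Pp dist p la -> W mu la <= W mu nu + W nu la.
Proof.
move=> Pmu Pnu Pla; apply/ler_addgt0Pr => e e0.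
have p0 : 0 < p by exact: lt_trans p1.
have e3 : 0 < e / 3 by rewrite divr_gt0.
have e3' a : a < a + e / 3 by rewrite ltrDl.
have [g cg gc] := Wp_lt_coupling Pd p1 Pmu Pnu (e3' _).
have [h ch hc] := Wp_lt_coupling Pd p1 Pnu Pla (e3' _).
have [P [P1 P2 Pe]] := approximate_gluing cg ch e3.
have W0 := @Wp_ge0 R dX X dist p.
have mp (f1 f2 : (X * X) * (X * X) -> X) :
    measurable_fun setT f1 -> measurable_fun setT f2 ->
    measurable_fun setT (fun z => dist (f1 z) (f2 z)).
  move=> mf1 mf2; have mh : measurable_fun setT (fun z => (f1 z, f2 z)).
    exact: measurable_fun_pair.
  exact: (measurableT_comp (measurable_dist Pd) mh).
have m11 : measurable_fun setT (fun z : (X * X) * (X * X) => z.1.1).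
  exact: measurableT_comp.
have m12 : measurable_fun setT (fun z : (X * X) * (X * X) => z.1.2).
  exact: measurableT_comp.
have m21 : measurable_fun setT (fun z : (X * X) * (X * X) => z.2.1).
  exact: measurableT_comp.
have m22 : measurable_fun setT (fun z : (X * X) * (X * X) => z.2.2).
  exact: measurableT_comp.
have c0 : 0 <= W mu nu + W nu la + e.
  by rewrite !addr_ge0// ltW.
apply: (Wp_le_image Pd p1 (P := P) (h1 := fun z => z.1.1)
  (h2 := fun z => z.2.2)) => //.
- move=> A mA; rewrite -(cg A mA).1 -P1; last exact: measurableX.
  by congr (P _); apply/seteqP; split => x //= [].
- move=> A mA; rewrite -(ch A mA).2 -P2; last exact: measurableX.
  by congr (P _); apply/seteqP; split => x //= [].
rewrite Lnorm_powR ?gt_eqF//; last by move=> z; exact: dist_ge0.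
rewrite -poweR_EFin; apply: gt0_ler_poweR; rewrite ?in_itv/= ?leey ?(ltW p0)//.
  by rewrite Lnorm_ge0.
  by rewrite lee_fin c0.
apply: (le_trans (@Lnorm_triangle3 _ _ _ P _ (fun z => dist z.1.1 z.1.2)
  (cst (e / 3)) (fun z => dist z.2.1 z.2.2) _ (ltW p1) _ _ _ _ _ _)) => //.
- exact: mp.
- exact: mp.
- exact: mp.
- by move=> z; exact: dist_ge0.
- apply: filterS Pe => z ze.
  rewrite (le_trans (dist_triangle Pd z.2.1 _ _))// lerD2r.
  by rewrite (le_trans (dist_triangle Pd z.1.2 _ _))// lerD2l.
have bound (q : probability (X * X)%type R) (f : (X * X) * (X * X) -> X * X) c :
    measurable_fun setT f ->
    (forall S, measurable S -> P (f @^-1` S) = q S) -> 0 <= c ->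
    (\int[q]_z (dist z.1 z.2 `^ p)%:E < (c `^ p)%:E)%E ->
    ('N[P]_p%:E[EFin \o (fun z => dist (f z).1 (f z).2)] <= c%:E)%E.
  move=> mf Pq c0' qc.
  rewrite -[leLHS]poweRe1 ?Lnorm_ge0// -(mulfV (lt0r_neq0 p0)) poweRrM.
  rewrite -Lnorm_powR ?gt_eqF//; last by move=> z; exact: dist_ge0.
  rewrite (ge0_integral_marginal mf Pq (f := fun z => (dist z.1 z.2 `^ p)%:E)).
  - rewrite -[c in leRHS]powRr1// -(mulfV (lt0r_neq0 p0)) powRrM -poweR_EFin.
    apply: gt0_ler_poweR; rewrite ?invr_ge0 ?(ltW p0) ?in_itv/= ?leey//.
    - by rewrite andbT cost_ge0.
    - by rewrite lee_fin powR_ge0.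
    - exact: ltW.
  - exact: measurable_cost.
  - by move=> z; rewrite lee_fin powR_ge0.
have E1 := bound g fst _ measurable_fst P1 (addr_ge0 (W0 _ _) (ltW e3)) gc.
have E3 := bound h snd _ measurable_snd P2 (addr_ge0 (W0 _ _) (ltW e3)) hc.
have E2 c : 0 <= c -> ('N[P]_p%:E[EFin \o cst c] <= c%:E)%E.
  move=> c0'.
  rewrite -[leLHS]poweRe1 ?Lnorm_ge0// -(mulfV (lt0r_neq0 p0)) poweRrM.
  rewrite -Lnorm_powR ?gt_eqF//.
  rewrite /= integral_cst//.
  rewrite -[c in leRHS]powRr1// -(mulfV (lt0r_neq0 p0)) powRrM -[leRHS]poweR_EFin.
  apply: gt0_ler_poweR; rewrite ?invr_ge0 ?(ltW p0) ?in_itv/= ?leey//.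
  - by rewrite andbT mule_ge0// lee_fin powR_ge0.
  - by rewrite lee_fin powR_ge0.
  - rewrite -[leRHS]mule1 lee_wpmul2l ?lee_fin ?powR_ge0//.
    exact: (probability_le1 P measurableT).
apply: (le_trans (leeD (leeD E1 (E2 _ (ltW e3))) E3)).
rewrite -!EFinD lee_fin; clear; lra.
Qed.

End gluing.

(** * The Levy-Prokhorov distance *)

Section levy_prokhorov.
Context {R : realType} {dX : measure_display} {X : measurableType dX}.
Context {dist : X -> X -> R} (Pd : polish_borel dist).
Implicit Types (mu nu la : probability X R) (e c : R).

Let close mu nu e := forall A : set X, measurable A ->
  (mu A <= nu (enlarge dist A e) + e%:E)%E /\
  (nu A <= mu (enlarge dist A e) + e%:E)%E.

Let dLP_setE mu nu : dLP dist mu nu = inf [set e | 0 < e /\ close mu nu e].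
Proof. by []. Qed.

Let has_lbound_dLP mu nu : has_lbound [set e | 0 < e /\ close mu nu e].
Proof. by exists 0 => e [/ltW]. Qed.

(** Makes the set under [inf] nonempty, so that the infimum in [dLP] is not a default value. *)
Let close1 mu nu : close mu nu 1.
Proof.
by move=> A mA; split; rewrite (le_trans (probability_le1 _ mA))// leeDr.
Qed.

Lemma dLP_ge0 mu nu : 0 <= dLP dist mu nu.
Proof.
rewrite dLP_setE; apply: lb_le_inf; last by move=> e [/ltW].
by exists 1; split => //; exact: close1.
Qed.

Lemma dLP_le mu nu e : 0 < e -> close mu nu e -> dLP dist mu nu <= e.
Proof. by move=> e0 h; apply: ge_inf => //; exact: has_lbound_dLP. Qed.

Lemma dLP_lt mu nu c : dLP dist mu nu < c ->
  exists e, [/\ 0 < e, e < c & close mu nu e].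
Proof.
move=> h; have [||e [e0 ce] ec] := @inf_adherent _
  [set e | 0 < e /\ close mu nu e] (c - dLP dist mu nu).
- by rewrite subr_gt0.
- by split; [exists 1; split => //; exact: close1|exact: has_lbound_dLP].
- by exists e; split => //; move: ec; rewrite -dLP_setE addrC subrK.
Qed.

Lemma dLP_triangle nu mu la :
  dLP dist mu la <= dLP dist mu nu + dLP dist nu la.
Proof.
apply/ler_addgt0Pr => r r0.
have r2 : 0 < r / 2 by rewrite divr_gt0.
have [|e [e0 er ec]] := @dLP_lt mu nu (dLP dist mu nu + r / 2).
  by rewrite ltrDl.
have [|f [f0 fr fc]] := @dLP_lt nu la (dLP dist nu la + r / 2).
  by rewrite ltrDl.
have ef : e + f <= dLP dist mu nu + dLP dist nu la + r by lra.
apply: le_trans ef; apply: dLP_le; first exact: addr_gt0.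
have step (m1 m2 m3 : probability X R) (a b : R) A : measurable A ->
    (forall B, measurable B -> m1 B <= m2 (enlarge dist B a) + a%:E)%E ->
    (forall B, measurable B -> m2 B <= m3 (enlarge dist B b) + b%:E)%E ->
    (m1 A <= m3 (enlarge dist A (a + b)) + (a + b)%:E)%E.
  move=> mA h1 h2; apply: (le_trans (h1 A mA)).
  rewrite EFinD addeA addeAC leeD2r//.
  apply: (le_trans (h2 _ (measurable_enlarge Pd A a))); rewrite leeD2r//.
  apply: le_measure; rewrite ?inE; [exact: measurable_enlarge..|].
  move=> x [y [z Az yz] xy]; exists z => //.
  by rewrite (le_lt_trans (dist_triangle Pd y _ _))// addrC ltrD.
move=> A mA; split.
  by apply: (@step mu nu la) => // B mB; [case: (ec B mB)|case: (fc B mB)].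
rewrite (addrC e f).
by apply: (@step la nu mu) => // B mB; [case: (fc B mB)|case: (ec B mB)].
Qed.

Context {p : R} (p1 : 1 < p).

(* Markov's inequality: a coupling of cost less than [e ^ p * e] gives mass
   at most [e] to the pairs at distance at least [e]. *)
Lemma dLP_le_Wp mu nu e : Pp dist p mu -> Pp dist p nu -> 0 < e ->
  Wp dist p mu nu < e * e `^ p^-1 -> dLP dist mu nu <= e.
Proof.
move=> Pmu Pnu e0 /(Wp_lt_coupling Pd p1 Pmu Pnu)[g cg].
have p0 : 0 < p by exact: lt_trans p1.
have ep0 : 0 < e `^ p by exact: powR_gt0.
rewrite powRM ?powR_ge0 ?(ltW e0)// -powRrM mulVf ?gt_eqF// powRr1 ?(ltW e0)// => gc.
have md := measurable_dist Pd.
(* The inequality in [D] is large because the one in [enlarge] is strict: off [D], a partner of a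
   point of [A] lies in [enlarge dist A e]. *)
pose D := [set z : X * X | e <= dist z.1 z.2].
have mD : measurable D.
  rewrite (_ : D = setT `&` (fun z : X * X => dist z.1 z.2) @^-1` `[e, +oo[).
    by apply: md => //; exact: measurable_itv.
  by apply/seteqP; split => z /=; rewrite in_itv/= andbT => // -[].
have gD : (g D <= e%:E)%E.
  rewrite -(@lee_pmul2l _ (e `^ p)%:E) ?lte_fin// -EFinM.
  apply: le_trans (ltW gc).
  rewrite -(setIT D) -integral_indic// -ge0_integralZl//; last 2 first.
    exact/measurable_EFinP.
    by rewrite lee_fin ltW.
  apply: ge0_le_integral => //.
  - by move=> z _; rewrite -EFinM lee_fin mulr_ge0 ?powR_ge0.
  - by apply/measurable_EFinP; apply: measurable_funM.
  - exact: measurable_cost.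
  - move=> z _; rewrite -EFinM lee_fin indicE.
    have [|_] := boolP (z \in D); last by rewrite mulr0 powR_ge0.
    rewrite inE /D/= mulr1 => ez.
    by apply: ge0_ler_powR; rewrite ?nnegrE ?(ltW p0) ?(ltW e0)// dist_ge0.
apply: dLP_le => // A mA; have mAe := measurable_enlarge Pd A e.
have mU B : measurable B -> measurable (B `|` D) by move=> mB; exact: measurableU.
split.
- rewrite -(cg A mA).1 -(cg _ mAe).2.
  apply: (@le_trans _ _ (g ((setT `*` enlarge dist A e) `|` D))).
    apply: le_measure; rewrite ?inE.
    + exact: measurableX.
    + by apply: mU; exact: measurableX.
    + move=> [x y] [/= Ax _]; rewrite /D/=.
      have [exy|xye] := leP e (dist x y); [by right|left; split => //].
      by exists x => //; rewrite (dist_sym Pd).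
  apply: (le_trans (measureU2 _ _ _)) => //; first exact: measurableX.
  by rewrite leeD2l.
- rewrite -(cg A mA).2 -(cg _ mAe).1.
  apply: (@le_trans _ _ (g ((enlarge dist A e `*` setT) `|` D))).
    apply: le_measure; rewrite ?inE.
    + exact: measurableX.
    + by apply: mU; exact: measurableX.
    + move=> [x y] [/= _ Ay]; rewrite /D/=.
      have [exy|xye] := leP e (dist x y); [by right|left; split => //].
      by exists y.
  apply: (le_trans (measureU2 _ _ _)) => //; first exact: measurableX.
  by rewrite leeD2l.
Qed.

End levy_prokhorov.

(** * Absolutely continuous functions and metric derivatives *)

Section primitive.
Context {R : realType}.
Local Notation leb := (@lebesgue_measure R).
Implicit Types (f g m : R -> R) (a b s t x : R).

(** The base point [-oo] asks for integrability on the whole line, but gives increments over []a,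
    b]] without any discussion of signs. *)
Definition primitive g x := (\int[leb]_(t in `]-oo, x]) g t)%R.

Lemma primitiveB g a b : leb.-integrable setT (EFin \o g) -> a <= b ->
  primitive g b - primitive g a = (\int[leb]_(t in `]a, b]) g t)%R.
Proof.
by move=> ig ab; apply: Rintegral_itvB; rewrite ?bnd_simp//; exact: integrableS ig.
Qed.

Lemma EFin_primitiveB g a b : leb.-integrable setT (EFin \o g) -> a <= b ->
  ((primitive g b - primitive g a)%:E = \int[leb]_(t in `]a, b]) (g t)%:E)%E.
Proof.
move=> ig ab; rewrite primitiveB// /Rintegral fineK//.
by apply: integrable_fin_num => //; exact: integrableS ig.
Qed.

Lemma primitive_continuous g : leb.-integrable setT (EFin \o g) ->
  continuous (primitive g).
Proof.
move=> ig x.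
have ab : x - 1 < x + 1 by lra.
have ig' : leb.-integrable `[x - 1, x + 1] (EFin \o g) by exact: integrableS ig.
have := parameterized_integral_continuous (ltW ab) ig'.
move=> /(continuous_within_itvP _ ab)[+ _ _] => /(_ x).
have xab : x \in `](x - 1), (x + 1)[ by rewrite in_itv/=; apply/andP; split; lra.
move=> /(_ xab) cx.
(* Near [x] the primitive is the integral from [x - 1] plus a constant. *)
have h : {near x, (fun y => parameterized_integral leb (x - 1) y g +
    primitive g (x - 1)) =1 primitive g}.
  near=> y.
  have xy : x - 1 <= y by rewrite ltW//; near: y; apply: lt_nbhsr; lra.
  rewrite -[RHS](subrK (primitive g (x - 1))) primitiveB//; congr (_ + _).
  rewrite Rintegral_itv_obnd_cbnd//.
  by apply: (integrableS measurableT) => //.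
rewrite /prop_for /continuous_at -(nbhs_singleton h).
by apply: cvg_trans (near_eq_cvg h) _; apply: cvgD => //; exact: cvg_cst.
Unshelve. all: by end_near. Qed.

Lemma primitive_nd g : leb.-integrable setT (EFin \o g) -> (forall x, 0 <= g x) ->
  {homo primitive g : a b / a <= b}.
Proof.
move=> ig g0 a b ab; rewrite -subr_ge0 primitiveB//.
by apply: Rintegral_ge0 => x _.
Qed.

Lemma primitive_ae g : leb.-integrable setT (EFin \o g) ->
  {ae leb, forall x, derivable (primitive g) x 1 /\ derive1 (primitive g) x = g x}.
Proof.
move=> ig; apply: FTC1Ny; first by move=> y; exact: integrableS ig.
exact: open_integrable_locally openT ig.
Qed.

End primitive.

Section density_measure.
Context d (T : measurableType d) {R : realType} (mu : {measure set T -> \bar R})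
  (f : T -> \bar R) (mf : measurable_fun setT f) (f0 : forall x, (0 <= f x)%E).

(** The two proofs are carried in the term so that the measure instance, which depends on them, can
    be inferred from it. *)
Definition density_measure (_ : measurable_fun setT f)
  (_ : forall x, (0 <= f x)%E) (A : set T) := (\int[mu]_(x in A) f x)%E.

Let nu := density_measure mf f0.

Let nu0 : nu set0 = 0%E. Proof. exact: integral_set0. Qed.

Let nu_ge0 A : (0 <= nu A)%E. Proof. exact: integral_ge0. Qed.

Let nu_additive : semi_sigma_additive nu.
Proof. exact: semi_sigma_additive_nng_induced. Qed.

HB.instance Definition _ := isMeasure.Build _ _ _ nu nu0 nu_ge0 nu_additive.

End density_measure.

Lemma stieltjes_itvoc (R : realType) (F : cumulative R R) (a b : R) : a <= b ->
  lebesgue_stieltjes_measure F `]a, b]%classic = (F b - F a)%:E.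
Proof.
move=> ab; rewrite /lebesgue_stieltjes_measure /measure_extension.
rewrite measurable_mu_extE/=; last exact: is_ocitv.
by rewrite wlength_itv_bnd.
Qed.

Lemma stieltjes_unique (R : realType) (F : cumulative R R)
    (m : {measure set (measurableTypeR R) -> \bar R}) :
  (forall a b, a < b -> m `]a, b]%classic = (F b - F a)%:E) ->
  forall A, measurable A -> lebesgue_stieltjes_measure F A = m A.
Proof.
move=> mE; apply: lebesgue_stieltjes_measure_unique => _ /ocitvP[->|[[a b] /= ab ->]].
  by rewrite !measure0.
by rewrite mE// stieltjes_itvoc// ltW.
Qed.

Section absolute_continuity.
Context {R : realType}.
Local Notation leb := (@lebesgue_measure R).

(* The Stieltjes measures of the nondecreasing functions [M + f] and [M - f],
   where [M] is the primitive of [m], add up to the measure of density [2 m],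
   so that Radon-Nikodym applies to the first one. *)
Lemma increments_le_primitive (f m : R -> R) :
  leb.-integrable setT (EFin \o m) -> (forall x, 0 <= m x) ->
  (forall s t, s <= t -> `|f t - f s| <= primitive m t - primitive m s) ->
  exists2 g : R -> R, leb.-integrable setT (EFin \o g) &
    forall s t, s <= t -> f t - f s = primitive g t - primitive g s.
Proof.
move=> im m0 fm; pose M := primitive m.
have cM : continuous M by exact: primitive_continuous.
have cf : continuous f.
  move=> x; apply/cvgrPdist_le => e e0.
  have := cM x => /cvgrPdist_le/(_ e e0); apply: filterS => y; apply: le_trans.
  have [xy|yx] := leP x y.
    by rewrite distrC (le_trans (fm _ _ xy))// distrC ler_norm.
  by rewrite (le_trans (fm _ _ (ltW yx)))// ler_norm.
pose F x := M x + f x; pose H x := M x - f x.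
have ndF : nondecreasing F.
  move=> s t st; have := fm s t st; rewrite ler_norml /F /M; lra.
have ndH : nondecreasing H.
  move=> s t st; have := fm s t st; rewrite ler_norml /H /M; lra.
have cF : continuous F by move=> x; apply: cvgD; [exact: cM|exact: cf].
have cH : continuous H by move=> x; apply: cvgB; [exact: cM|exact: cf].
have ndM2 : nondecreasing (fun x => M x + M x).
  by move=> s t st; rewrite lerD// primitive_nd.
have cM2 : continuous (fun x => M x + M x).
  by move=> x; apply: cvgD; exact: cM.
pose F' : cumulative R R :=
  HB.pack F (isCumulative.Build R _ R F ndF (right_continuousW cF)).
pose H' : cumulative R R :=
  HB.pack H (isCumulative.Build R _ R H ndH (right_continuousW cH)).
pose M' : cumulative R R :=
  HB.pack (fun x => M x + M x)
  (isCumulative.Build R _ R (fun x => M x + M x) ndM2 (right_continuousW cM2)).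
pose muF := lebesgue_stieltjes_measure F'.
pose muH := lebesgue_stieltjes_measure H'.
have im2 : leb.-integrable setT (EFin \o (fun x => m x + m x)).
  by have := integrableD measurableT im im.
have mm2 : measurable_fun setT (EFin \o (fun x => m x + m x)).
  exact: (measurable_int leb).
have m20 x : (0 <= (EFin \o (fun x => m x + m x)%R) x)%E.
  by rewrite lee_fin addr_ge0.
pose nu := density_measure leb mm2 m20.
have nuE A : measurable A -> lebesgue_stieltjes_measure M' A = nu A.
  apply: (@stieltjes_unique _ M' nu) => a b ab.
  transitivity (\int[leb]_(x in `]a, b]) ((m x)%:E + (m x)%:E))%E => //.
  rewrite integralD//=; [|by apply: (integrableS measurableT)..].
  rewrite -EFin_primitiveB ?(ltW ab)// -EFinD; congr EFin; rewrite /M'/= -/M; lra.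
have addE A : measurable A ->
    lebesgue_stieltjes_measure M' A = (muF A + muH A)%E.
  move=> mA.
  transitivity (measure_add muF muH A); last exact: measure_addE.
  apply: (@stieltjes_unique _ M' (measure_add muF muH)) => // a b ab.
  transitivity (muF `]a, b]%classic + muH `]a, b]%classic)%E.
    exact: measure_addE.
  rewrite /muF /muH !stieltjes_itvoc ?(ltW ab)// -EFinD.
  congr EFin; rewrite /= /F /H; lra.
(* This comparison provides both what Radon-Nikodym requires of [muF]: finite mass and domination by
   [leb]. *)
have muF_nu A : measurable A -> (muF A <= nu A)%E.
  by move=> mA; rewrite -nuE// addE// leeDl.
have muFT : (muF setT < +oo)%E.
  apply: (le_lt_trans (muF_nu _ measurableT)).
  rewrite /nu /density_measure; have /integrableP[_] := im2.
  move=> /(le_lt_trans _); apply; rewrite le_eqVlt; apply/orP; left; apply/eqP.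
  by apply: eq_integral => x _; rewrite gee0_abs//; exact: m20.
pose muF1 := mfrestr measurableT muFT.
have muF1E A : muF1 A = muF A by rewrite /muF1 /mfrestr /mrestr setIT.
have dom : muF1 `<< leb.
  apply/null_content_dominatesP => A mA A0; apply/eqP.
  rewrite eq_le measure_ge0 andbT muF1E (le_trans (muF_nu _ mA))//.
  rewrite /nu /density_measure (null_set_integral mA)//.
  exact: (measurable_funS _ _ mm2).
have [h [h0 hfin ih hE]] := radon_nikodym_sigma_finite dom.
have ih' : leb.-integrable setT (EFin \o (fine \o h)).
  by apply: eq_integrable ih => // x _ /=; rewrite fineK.
(* [h] is the density of [F = M + f], hence [h - m] is that of [f]. *)
exists (fun x => fine (h x) - m x).
  by have := integrableB measurableT ih' im.
move=> s t st; apply: EFin_inj.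
rewrite EFin_primitiveB//; last by have := integrableB measurableT ih' im.
rewrite (eq_integral (fun x => ((EFin \o (fine \o h)) x - (EFin \o m) x)%E))//.
rewrite integralB//; [|by apply: (integrableS measurableT)..].
rewrite (eq_integral h); last by move=> x _ /=; rewrite fineK.
have -> : (\int[leb]_(x in `]s, t]) h x = (F t - F s)%:E)%E.
  apply: (etrans (esym (hE _ _))); first exact: measurable_itv.
  by apply: (etrans (muF1E _)); exact: (@stieltjes_itvoc _ F').
rewrite -EFin_primitiveB//.
by rewrite -EFinB; congr EFin; rewrite /F /M; lra.
Qed.

End absolute_continuity.

Section metric_derivative.
Context {R : realType}.
Local Notation leb := (@lebesgue_measure R).
Implicit Types (f g m : R -> R) (s t x : R).

Lemma derivable_slope_cvg f t : derivable f t 1 ->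
  (f s - f t) / (s - t) @[s --> t^'] --> derive1 f t.
Proof.
move=> df; rewrite derive1E.
have sub : (fun s => s - t) @ t^' --> (0 : R)^'.
  move=> A [e e0 he]; exists e => // s /= ts st.
  apply: he; last by rewrite subr_eq0.
  by move: ts; rewrite /ball/= sub0r normrN distrC.
have := cvg_comp _ _ sub df; apply: cvg_trans; apply: near_eq_cvg.
near=> s; rewrite /= scaler1 subrK mulrC.
by [].
Unshelve. all: by end_near. Qed.

Lemma slope_norm_cvg f t : derivable f t 1 ->
  `|f s - f t| / `|t - s| @[s --> t^'] --> `|derive1 f t|.
Proof.
move=> /derivable_slope_cvg/cvg_norm; apply: cvg_trans; apply: near_eq_cvg.
by near=> s; rewrite normrM normfV (distrC t).
Unshelve. all: by end_near. Qed.

Context (D : R -> R -> R) (m : R -> R).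
Hypothesis (Dsym : forall s t, D s t = D t s).
Hypothesis Dtri : forall s t x, D s x <= D s t + D t x.
Hypotheses (im : leb.-integrable setT (EFin \o m)) (m0 : forall x, 0 <= m x).
Hypothesis Dm : forall s t, s <= t -> D s t <= primitive m t - primitive m s.

Let D_dist x s t : `|D t x - D s x| <= D s t.
Proof.
rewrite ler_norml; have := Dtri t s x; have := Dtri s t x.
by rewrite (Dsym t s); lra.
Qed.

Let D_le_abs s t : D s t <= `|primitive m s - primitive m t|.
Proof.
have [st|/ltW ts] := leP s t.
  by rewrite (le_trans (Dm st))// distrC ler_norm.
by rewrite Dsym (le_trans (Dm ts))// ler_norm.
Qed.

Lemma dense_sequence : exists r : nat -> R,
  forall x e, 0 < e -> exists n, `|x - r n| < e.
Proof.
exists (fun n => if unpickle n is Some q then ratr q else 0) => x e e0.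
have xe : x - e < x + e by lra.
have [q] := rat_in_itvoo xe; rewrite in_itv/= => qxe.
exists (pickle q); rewrite pickleK distrC ltr_distl; lra.
Qed.

(* The metric derivative is the supremum over a dense sequence [r] of the
   absolute derivatives of the functions [D ^~ (r n)]. *)
Lemma metric_derivative_exists : exists v : R -> R,
  [/\ leb.-integrable setT (EFin \o v), forall x, 0 <= v x,
      forall s t, s <= t -> D s t <= primitive v t - primitive v s &
      {ae leb, forall t, D t s / `|t - s| @[s --> t^'] --> v t}].
Proof.
have aeF := ae_filter_ringOfSetsType leb.
have [r rd] := dense_sequence.
have /choice[g gP] : forall n, exists g, leb.-integrable setT (EFin \o g) /\
    forall s t, s <= t -> D t (r n) - D s (r n) = primitive g t - primitive g s.
  move=> n; have [|g ig gE] :=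
    @increments_le_primitive R (fun t => D t (r n)) m im m0.
    by move=> s t st; rewrite (le_trans (D_dist _ _ _))// Dm.
  by exists g.
have ig n := (gP n).1; have gE n := (gP n).2.
(* [|g n t| <= m t] will hold only almost everywhere; truncation by [m] makes the supremum over [n]
   finite at every point and integrable. *)
pose w n t := Num.min `|g n t| (m t).
have mm : measurable_fun setT m.
  by apply/measurable_EFinP; exact: (measurable_int leb).
have mg n : measurable_fun setT (g n).
  by apply/measurable_EFinP; exact: (measurable_int leb).
have mw n : measurable_fun setT (w n).
  by apply: measurable_minr => //; exact: measurableT_comp.
pose v t := sups (w ^~ t) 0.
have wm n t : w n t <= m t by rewrite /w ge_min lexx orbT.
have w0 n t : 0 <= w n t by rewrite /w le_min normr_ge0 m0.
have vE t : v t = sup (range (w ^~ t)).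
  by rewrite /v /sups /sdrop; congr sup; apply/seteqP; split => _ [k _ <-]; exists k.
have ub t : has_ubound (range (w ^~ t)) by exists (m t) => _ [n _ <-].
have wv n t : w n t <= v t by rewrite vE; apply: ub_le_sup => //; exists n.
have vm t : v t <= m t.
  by rewrite vE; apply: ge_sup; [exists (w 0 t), 0|move=> _ [n _ <-]].
have v0 t : 0 <= v t by rewrite (le_trans (w0 0 t)).
have mv : measurable_fun setT v by apply: measurable_fun_sups.
have iv : leb.-integrable setT (EFin \o v).
  apply: le_integrable im => //; first exact/measurable_EFinP.
  by move=> x _; rewrite !abse_EFin lee_fin !ger0_norm.
have aeg : {ae leb, forall t, forall n,
    derivable (primitive (g n)) t 1 /\ derive1 (primitive (g n)) t = g n t}.
  by apply: ae_foralln => n; exact: primitive_ae.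
have slopeg n t : derivable (primitive (g n)) t 1 ->
    derive1 (primitive (g n)) t = g n t ->
    `|D s (r n) - D t (r n)| / `|t - s| @[s --> t^'] --> `|g n t|.
  move=> dg <-; apply: cvg_trans (slope_norm_cvg dg).
  apply: near_eq_cvg; near=> s; rewrite (_ : D s (r n) - D t (r n) =
    primitive (g n) s - primitive (g n) t)//.
  by have [/(gE n)|/ltW/(gE n)] := leP s t; lra.
(* The slopes of [D ^~ (r n)] are dominated by those of [primitive m]; pass to the limit where both
   are differentiable. *)
have aegm : {ae leb, forall t, forall n, `|g n t| <= m t}.
  apply: filterS2 aeg (primitive_ae im) => t tg [dm dmE] n.
  have [dg dgE] := tg n.
  have := slope_norm_cvg dm; rewrite dmE ger0_norm// => cm.
  apply: (ler_cvg_to (slopeg n t dg dgE) cm).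
  near=> s; rewrite ler_pM2r ?invr_gt0; last first.
    rewrite normr_gt0 subr_eq0 eq_sym.
    by near: s; exact: nbhs_dnbhs_neq.
  by rewrite (le_trans (D_dist _ _ _))// Dsym D_le_abs.
(* Choose [r n] close to [s]. Then [D s t <= D s (r n) + D t (r n)], which is twice [D s (r n)] plus
   the increment of [primitive (g n)]; hence the margin [e / 2]. *)
have Dv s t : s <= t -> D s t <= primitive v t - primitive v s.
  move=> st; apply/ler_addgt0Pr => e e0.
  have e2 : 0 < e / 2 by rewrite divr_gt0.
  have /cvgrPdist_lt/(_ _ e2) := @primitive_continuous _ m im s.
  move=> [d d0 hd]; have [n sn] := rd s d d0.
  have Dsn : D s (r n) <= e / 2.
    by rewrite (le_trans (D_le_abs _ _))// ltW// hd.
  have gv : `|primitive (g n) t - primitive (g n) s| <=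
      primitive v t - primitive v s.
    rewrite !primitiveB//.
    have igst h : leb.-integrable setT (EFin \o h) ->
      leb.-integrable `]s, t] (EFin \o h).
      by move=> ih; exact: (integrableS measurableT).
    apply: (le_trans (le_normr_Rintegral _ (igst _ (ig n)))) => //.
    rewrite -lee_fin /Rintegral !fineK.
    - have mng : measurable_fun setT (fun x => `|g n x|).
        exact: measurableT_comp.
      apply: ae_ge0_le_integral => //.
      + exact/measurable_funTS/measurable_EFinP.
      + by move=> x _; rewrite lee_fin.
      + exact/measurable_funTS/measurable_EFinP.
      + apply: filterS aegm => x gm _; rewrite lee_fin.
        by have := wv n x; rewrite /w min_l.
    - by apply: integrable_fin_num => //; exact: igst.
    - apply: integrable_fin_num => //; apply: igst.
      by have := integrable_abse (ig n).
  have := Dtri s (r n) t; have := gE n s t st.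
  have := ler_norm (primitive (g n) t - primitive (g n) s).
  rewrite (Dsym (r n) t); move: Dsn gv; lra.
exists v; split => //.
apply: filterS3 aeg aegm (primitive_ae iv) => t tg tgm [dv dvE].
have cv : `|primitive v s - primitive v t| / `|t - s| @[s --> t^'] --> v t.
  by have := slope_norm_cvg dv; rewrite dvE ger0_norm.
apply/cvgrPdist_lt => e e0.
have [||_ [n _ <-] vn] := @sup_adherent R (range (w ^~ t)) (e / 2).
- by rewrite divr_gt0.
- by split => //; exists (w 0 t), 0.
move: vn; rewrite -vE => vn.
have [dg dgE] := tg n.
have e2 : 0 < e / 2 by rewrite divr_gt0.
have /cvgrPdist_lt/(_ _ e2) cn := slopeg n t dg dgE.
have /cvgrPdist_lt/(_ _ e0) cve := cv.
(* Squeeze: the quotient lies below the slope of [primitive v], which tends to [v t], and above the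
   slope of [D ^~ (r n)], whose limit exceeds [v t - e / 2]. *)
near=> s.
have st : 0 < `|t - s|^-1.
  rewrite invr_gt0 normr_gt0 subr_eq0 eq_sym.
  by near: s; exact: nbhs_dnbhs_neq.
have up : D t s / `|t - s| <= `|primitive v s - primitive v t| / `|t - s|.
  rewrite ler_pM2r//; have [ts|/ltW ts] := leP t s.
    by rewrite (le_trans (Dv _ _ ts))// ler_norm.
  by rewrite Dsym (le_trans (Dv _ _ ts))// distrC ler_norm.
have lo : `|D s (r n) - D t (r n)| / `|t - s| <= D t s / `|t - s|.
  by rewrite ler_pM2r.
have vs : `|v t - `|primitive v s - primitive v t| / `|t - s| | < e.
  by near: s.
have gs : `| `|g n t| - `|D s (r n) - D t (r n)| / `|t - s| | < e / 2.
  by near: s.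
have wE : w n t = `|g n t| by rewrite /w min_l.
rewrite wE in vn; move: up lo vs gs.
set a := D t s / _; set b := `|primitive v s - _| / _.
set c := `|D s (r n) - _| / _; rewrite !ltr_norml; move: vn; clearbody a b c; lra.
Unshelve. all: by end_near. Qed.

End metric_derivative.

(** * Derivatives of monotone functions *)

Section monotone_derivative.
Context {R : realType}.
Local Notation leb := (@lebesgue_measure R).
Local Open Scope ereal_scope.

Lemma limn_einf_le (u : (\bar R)^nat) (c : \bar R) :
  (\forall n \near \oo, u n <= c) -> limn_einf u <= c.
Proof.
move=> uc; rewrite limn_einf_lim; apply: lime_le; first exact: is_cvg_einfs.
apply: filterS uc => n; apply: le_trans.
by apply: ereal_inf_lbound; exists n => /=.
Qed.

Lemma limn_einf_ge (u : (\bar R)^nat) (c : \bar R) :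
  (forall n, c <= u n) -> c <= limn_einf u.
Proof.
move=> uc; rewrite limn_einf_lim; apply: lime_ge; first exact: is_cvg_einfs.
by apply: nearW => n; apply: le_ereal_inf_tmp => _ [k _ <-].
Qed.

Lemma lebesgue_measure_shift (c : R) (A : set R) : measurable A ->
  leb ((fun x => x + c)%R @^-1` A) = leb A.
Proof.
move=> mA.
have mc : measurable_fun setT ((fun x => x + c)%R : _ -> measurableTypeR R).
  exact: measurable_funD.
suff : pushforward leb ((fun x => x + c)%R : _ -> measurableTypeR R) A = leb A.
  by [].
apply/esym/lebesgue_measure_unique => //= _ [[a b]] _ <-.
rewrite /pushforward (_ : _ @^-1` _ = `](a - c)%R, (b - c)%R]%classic); last first.
  apply/seteqP; split => x /=; rewrite !in_itv/=; lra.
rewrite !lebesgue_measure_itv/= !lte_fin ltrD2r.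
by case: ifPn => // _; rewrite -!EFinB; congr EFin; lra.
Qed.

Lemma ge0_integral_shift (a b c : R) (f : R -> R) : measurable_fun setT f ->
  (forall x, 0 <= f x)%R ->
  \int[leb]_(x in `[a, b]) (f (x + c))%:E =
  \int[leb]_(x in `[(a + c)%R, (b + c)%R]) (f x)%:E.
Proof.
move=> mf f0.
have mc : measurable_fun setT ((fun x => x + c)%R : _ -> measurableTypeR R).
  exact: measurable_funD.
rewrite (_ : `[a, b]%classic = ((fun x => x + c)%R : _ -> measurableTypeR R) @^-1`
    `[(a + c)%R, (b + c)%R]); last first.
  by apply/seteqP; split => x /=; rewrite !in_itv/= !lerD2r.
transitivity (\int[leb]_(x in ((fun x => x + c)%R : _ -> measurableTypeR R) @^-1`
  `[(a + c)%R, (b + c)%R])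
    ((EFin \o f) \o ((fun x => x + c)%R : _ -> measurableTypeR R)) x) => //.
rewrite -ge0_integral_pushforward//=.
- by apply: eq_measure_integral => A mA _; exact: lebesgue_measure_shift.
- exact/measurable_funTS/measurable_EFinP.
- by move=> x _; rewrite lee_fin.
Qed.

(** After a shift by [c], the integrals of [phi t] and [phi (t + c)] cancel except near the two
    ends, each of length [c]. The condition [c <= 1] lets the single endpoint [b + 1] serve for all
    steps. *)
Lemma ni_integral_increment_le (phi : R -> R) (a b c : R) :
  {homo phi : s t /~ (t <= s)%R} -> (a <= b)%R -> (0 < c)%R -> (c <= 1)%R ->
  \int[leb]_(t in `[a, b]) (c^-1 * (phi t - phi (t + c)))%:E <=
  (phi a - phi (b + 1))%:E.
Proof.
move=> ni ab c0 c1.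
have mphi : measurable_fun setT phi.
  by apply: nonincreasing_measurable.
(* Subtracting [phi (b + 1)] and truncating gives a nonnegative function with the same increments on
   the range used, so the calculus of nonnegative integrals applies. *)
pose k x := Num.max (phi x - phi (b + 1))%R 0%R.
have mk : measurable_fun setT k.
  by apply: measurable_maxr => //; exact: measurable_funB.
have k0 x : (0 <= k x)%R by rewrite /k le_max lexx orbT.
have kE x : (x <= b + 1)%R -> k x = (phi x - phi (b + 1))%R.
  by move=> xb; rewrite /k max_l// subr_ge0 ni.
have mkS A : measurable A -> measurable_fun A (EFin \o k).
  by move=> mA; exact/measurable_funTS/measurable_EFinP.
have mkc : measurable_fun setT (fun x : R => k (x + c)%R).
  by apply: (measurableT_comp mk); exact: measurable_funD.
have kni x y : (x <= y)%R -> (k y <= k x)%R.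
  move=> xy; rewrite /k ge_max !le_max lexx orbT andbT.
  by rewrite lerD2r ni.
have bound x y : (a <= x)%R -> (x <= y)%R ->
    \int[leb]_(t in `[x, y]) (k t)%:E <= ((y - x) * k a)%:E.
  move=> ax xy; apply: (@le_trans _ _ (\int[leb]_(t in `[x, y]) (cst (k a)%:E t))).
    apply: ge0_le_integral => //=.
    - by move=> t _; rewrite lee_fin.
    - exact: mkS.
    - move=> t; rewrite in_itv/= => /andP[xt _]; rewrite lee_fin kni//.
      exact: le_trans xt.
  rewrite integral_cst//= lebesgue_measure_itv/= lte_fin.
  case: ifPn => [_|]; first by rewrite -EFinB -EFinM mulrC.
  by rewrite mule0 lee_fin mulr_ge0// subr_ge0.
have key : \int[leb]_(t in `[a, b]) (k t - k (t + c))%:E <= (c * k a)%:E.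
  have I2fin : \int[leb]_(t in `[(a + c)%R, (b + c)%R]) (k t)%:E \is a fin_num.
    rewrite ge0_fin_numE; last by apply: integral_ge0 => t _; rewrite lee_fin.
    by apply: (le_lt_trans (bound _ _ _ _)); rewrite ?ltry//; lra.
  (* The shifted integral is added to both sides instead of subtracting integrals; its finiteness is
     what allows it to be cancelled. *)
  rewrite -(leeD2rE _ _ I2fin) -ge0_integral_shift//.
  rewrite -ge0_integralD//=; last 4 first.
  - move=> t _; rewrite lee_fin subr_ge0 kni//; lra.
  - by apply/measurable_funTS/measurable_EFinP/measurable_funB.
  - by move=> t _; rewrite lee_fin.
  - by apply/measurable_funTS/measurable_EFinP.
  under eq_integral do rewrite -EFinD subrK.
  have msub : measurable (`[a, (a + c)%R] `|` `](a + c)%R, (b + c)%R]).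
    exact: measurableU.
  apply: (@le_trans _ _ (\int[leb]_(t in `[a, (a + c)%R] `|` `](a + c)%R, (b + c)%R])
      (k t)%:E)).
    apply: ge0_subset_integral => //=.
    - exact: mkS.
    - by move=> t _; rewrite lee_fin.
    - move=> t /=; rewrite !in_itv/=; have [tac|tac] := leP t (a + c)%R.
        by move=> /andP[-> _]; left.
      by move=> /andP[_ tb]; right; lra.
  rewrite ge0_integral_setU//=; last 3 first.
  - exact: mkS.
  - by move=> t _; rewrite lee_fin.
  - apply/disj_setPS => t /= []; rewrite !in_itv/=; lra.
  apply: leeD; first by apply: (le_trans (bound _ _ _ _)); rewrite ?lee_fin; lra.
  rewrite ge0_integral_shift//; apply: ge0_subset_integral => //=.
  - exact: mkS.
  - by move=> t _; rewrite lee_fin.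
  - by apply: subset_itv; rewrite bnd_simp.
have -> : \int[leb]_(t in `[a, b]) (c^-1 * (phi t - phi (t + c)))%:E =
    \int[leb]_(t in `[a, b]) ((c^-1)%:E * (k t - k (t + c))%:E).
  apply: eq_integral => t; rewrite inE/= in_itv/= => /andP[at_ tb].
  by rewrite -EFinM !kE; [congr (_ * _)%:E; lra|lra|lra].
rewrite ge0_integralZl//=; last 3 first.
- by apply/measurable_funTS/measurable_EFinP/measurable_funB.
- by move=> t _; rewrite lee_fin subr_ge0 kni//; lra.
- by rewrite lee_fin invr_ge0 ltW.
apply: (@le_trans _ _ ((c^-1)%:E * (c * k a)%:E)).
  by rewrite lee_wpmul2l// lee_fin invr_ge0 ltW.
by rewrite -EFinM mulrA mulVf ?gt_eqF// mul1r kE//; lra.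
Qed.

(* Fatou's lemma applied to the difference quotients of [phi]. *)
Lemma ni_derivative_integral_le (phi : R -> R) :
  {homo phi : s t /~ (t <= s)%R} ->
  exists psi : R -> \bar R, [/\ measurable_fun setT psi, forall t, 0 <= psi t,
    forall a b, (a <= b)%R ->
      \int[leb]_(t in `[a, b]) psi t <= (phi a - phi (b + 1))%:E &
    forall t, derivable phi t 1 -> psi t = (- derive1 phi t)%:E].
Proof.
move=> ni; pose c n : R := n.+1%:R^-1%R.
have c0 n : (0 < c n)%R by rewrite invr_gt0.
have c1 n : (c n <= 1)%R by rewrite invf_le1// ler1n.
pose q n t := ((c n)^-1 * (phi t - phi (t + c n)))%:E.
have mphi : measurable_fun setT phi.
  by apply: nonincreasing_measurable.
have mq n : measurable_fun setT (q n).
  apply/measurable_EFinP/measurable_funM => //; apply: measurable_funB => //.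
  by apply: (measurableT_comp mphi); exact: measurable_funD.
have q0 n t : 0 <= q n t.
  by rewrite lee_fin mulr_ge0 ?invr_ge0 ?(ltW (c0 n))// subr_ge0 ni// lerDl ltW.
(* The lower limit is measurable and defined everywhere, and equals [- phi'] wherever [phi] is
   derivable. *)
exists (fun t => limn_einf (q ^~ t)); split.
- rewrite /limn_einf; apply: measurableT_comp => //.
  by apply: measurable_fun_limn_esup => n; exact: measurableT_comp.
- by move=> t; apply: limn_einf_ge.
- move=> a b ab; have := fatou leb (measurable_itv `[a, b])
    (fun n => measurable_funTS (mq n)) (fun n t _ => q0 n t).
  move=> /le_trans; apply.
  by apply/limn_einf_le/nearW => n; exact: ni_integral_increment_le.
- move=> t dphi; apply: (cvg_limn_einf_sup _).1.
  apply/cvg_EFin; first by near=> n.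
  have tc : (forall n, t + c n != t)%R /\ (t + c n)%R @[n --> \oo] --> t.
    split=> [n|]; first by rewrite -subr_eq0 addrAC subrr add0r gt_eqF.
    rewrite -[X in _ --> X]addr0; apply: cvgD; first exact: cvg_cst.
    exact: cvg_harmonic.
  have := (cvgr_dnbhsP _ _ _).1 (derivable_slope_cvg dphi) _ tc.
  move=> /cvgN; apply: cvg_trans; apply: near_eq_cvg; near=> n.
  rewrite /= -[LHS]/(- ((phi (t + c n) - phi t) / (t + c n - t)))%R.
  by rewrite [(t + c n)%R]addrC addrK -mulNr opprB mulrC.
Unshelve. all: by end_near. Qed.

End monotone_derivative.

(** * Curves of maximal slope *)

Section clamp.
Context {R : realType}.
Implicit Types s t T : R.

(** Retraction of the line onto [[0, T]]: composed with it, a curve on [[0, T]] extends to the whole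
    line, as the metric derivative lemma requires. *)
Definition clamp T t := if t < 0 then 0 else if t < T then t else T.

Lemma clamp_itv T t : 0 < T -> 0 <= clamp T t <= T.
Proof. by rewrite /clamp; case: (ltP t 0); [|case: (ltP t T)]; lra. Qed.

Lemma clamp_id T t : 0 <= t <= T -> clamp T t = t.
Proof. by rewrite /clamp; case: (ltP t 0); [|case: (ltP t T)]; lra. Qed.

Lemma clamp_le T s t : 0 < T -> s <= t -> clamp T s <= clamp T t.
Proof.
rewrite /clamp.
by case: (ltP s 0); case: (ltP t 0); case: (ltP s T); case: (ltP t T); lra.
Qed.

(** Strictness rules out two times on the same side of [[0, T]], the only case in which clamping
    could leave [[s, t]]. *)
Lemma clamp_lt T s t : 0 < T -> s <= t -> clamp T s < clamp T t ->
  s <= clamp T s /\ clamp T t <= t.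
Proof.
rewrite /clamp.
by case: (ltP s 0); case: (ltP t 0); case: (ltP s T); case: (ltP t T);
  split; lra.
Qed.

End clamp.

Section curves.
Context {R : realType} {dX : measure_display} {X : measurableType dX}.
Context {dist : X -> X -> R} (Pd : polish_borel dist) {p : R} (p1 : 1 < p).
Local Notation leb := (@lebesgue_measure R).
Local Notation W := (Wp dist p).
Implicit Types (rho : R -> probability X R).

Lemma AC_metric_derivative rho (T : R) : 0 < T -> AC_on dist p T rho ->
  exists v : R -> R,
  [/\ leb.-integrable setT (EFin \o v), forall x, 0 <= v x,
      forall s t, 0 <= s -> s <= t -> t <= T ->
        W (rho s) (rho t) <= primitive v t - primitive v s &
      {ae leb, forall t, 0 < t < T -> metric_deriv dist p rho t = v t}].
Proof.
move=> T0 [PT [m0 [im0 Wm0]]].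
have cl_itv t := clamp_itv t T0.
have Pcl x : Pp dist p (rho (clamp T x)) by exact: PT.
pose D s t := W (rho (clamp T s)) (rho (clamp T t)).
(* The given bound may change sign and is controlled on [[0, T]] only. *)
pose m := (fun x => `|m0 x|) \_ `[0, T].
have im : leb.-integrable setT (EFin \o m).
  rewrite /m -restrict_EFin; apply/(integrable_mkcond _ _).1 => //.
  by have := integrable_abse im0.
have m_ge0 x : 0 <= m x by rewrite /m patchE; case: ifPn => //= _.
have Dm s t : s <= t -> D s t <= primitive m t - primitive m s.
  move=> st.
  have := clamp_le T0 st.
  rewrite le_eqVlt => /predU1P[cst|cst].
    by rewrite /D cst Wp_xx// subr_ge0 primitive_nd.
  have /andP[s0 sT] := cl_itv s; have /andP[t0 tT] := cl_itv t.
  have [scl tcl] := clamp_lt T0 st cst.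
  rewrite /D Wp_sym// -lee_fin EFin_primitiveB//.
  apply: (le_trans (Wm0 _ _ s0 cst tT)).
  have isub : leb.-integrable `[clamp T s, clamp T t] (EFin \o m0).
    apply: integrableS im0 => // x /=; rewrite !in_itv/=; lra.
  have isub' : leb.-integrable `]clamp T s, clamp T t] (EFin \o m0).
    by apply: integrableS isub => // x /=; rewrite !in_itv/=; lra.
  rewrite -integral_itv_obnd_cbnd; last exact: (measurable_int leb isub').
  apply: (@le_trans _ _ (\int[leb]_(x in `]clamp T s, clamp T t]) (m x)%:E)%E).
    apply: le_integral => //.
    - by apply: (integrableS measurableT) im.
    - move=> x; rewrite inE/= in_itv/= => xst; rewrite lee_fin /m patchE mem_set/=.
        exact: ler_norm.
      rewrite in_itv/=; lra.
  apply: ge0_subset_integral => //.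
  - by apply: measurable_funTS; exact: (measurable_int leb).
  - by move=> x _; rewrite lee_fin.
  - by move=> x /=; rewrite !in_itv/=; lra.
have [v [iv v0 Dv dv]] := @metric_derivative_exists R D m
  (fun s t => Wp_sym Pd p1 (Pcl _) (Pcl _))
  (fun s t x => Wp_triangle Pd p1 (Pcl _) (Pcl _) (Pcl _)) im m_ge0 Dm.
exists v; split => //.
  move=> s t s0 st tT; have := Dv _ _ st; rewrite /D !clamp_id//; lra.
have aeF := ae_filter_ringOfSetsType leb.
apply: filterS dv => t cv /andP[t0 tT].
apply: cvg_lim; first exact: Rhausdorff.
apply: cvg_trans cv; apply: near_eq_cvg.
(* At interior times [clamp] is the identity nearby, so both difference quotients agree. *)
have : \forall s \near t, 0 < s < T.
  near=> s; apply/andP; split; near: s; [exact: lt_nbhsr|exact: lt_nbhsl].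
move=> /nbhs_dnbhs; apply: filterS => s /andP[s0 sT].
by rewrite /D !clamp_id//; lra.
Unshelve. all: by end_near. Qed.

End curves.

Section dissipation.
Context {R : realType} {dX : measure_display} {X : measurableType dX}.
Context {dist : X -> X -> R} (Pd : polish_borel dist) {p : R} (p1 : 1 < p).
Local Notation leb := (@lebesgue_measure R).
Local Notation W := (Wp dist p).
Local Notation q := (p / (p - 1)).

Let p_gt0 : 0 < p. Proof. exact: lt_trans p1. Qed.
Let q_gt0 : 0 < q. Proof. by rewrite divr_gt0// subr_gt0. Qed.

(** For [v > k] the factor [(v / k) ^ (p - 1)] exceeds [1]. This pointwise bound plays the part of
    Hölder's inequality in estimating a length by the integral of a [p]-th power. *)
Lemma le_add_powR (k v : R) : 0 < k -> 0 <= v ->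
  v <= k + k `^ (1 - p) * v `^ p.
Proof.
move=> k0 v0; have [vk|kv] := leP v k.
  by rewrite (le_trans vk)// lerDl mulr_ge0 ?powR_ge0.
have vp : 0 < v by exact: lt_trans kv.
apply: (@le_trans _ _ (k `^ (1 - p) * v `^ p)); last by rewrite lerDr ltW.
have -> : v `^ p = v * v `^ (p - 1).
  rewrite -[X in _ = X * _]powRr1// -powRD ?(gt_eqF vp) ?implybT//.
  by congr (powR v _); lra.
rewrite mulrCA ler_peMr//.
have k1 : k `^ (1 - p) * k `^ (p - 1) = 1.
  by rewrite -powRD ?(gt_eqF k0) ?implybT// (_ : 1 - p + (p - 1) = 0) ?powRr0//; lra.
rewrite -[leLHS]k1 ler_pM2l ?powR_gt0//.
by apply: ge0_ler_powR; rewrite ?nnegrE ?subr_ge0 ?(ltW p1) ?(ltW k0) ?(ltW kv).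
Qed.

(** The left-hand side is finite, whereas [G = +oo] would make the right-hand side [-oo]. *)
Lemma dissipation_fin (a dphi : R) (G : \bar R) : (0 <= G)%E ->
  dphi%:E = (- a%:E - q^-1%:E * poweR G q)%E ->
  exists2 g, G = g%:E & 0 <= g /\ - dphi = a + q^-1 * g `^ q.
Proof.
case: G => [g|_|//].
  rewrite lee_fin => g0; rewrite poweR_EFin -EFinM -EFinN -EFinB => -[->].
  by exists g => //; split => //; lra.
by rewrite poweRyr ?gt_eqF// gt0_muley ?lte_fin ?invr_gt0.
Qed.

Context (E G : probability X R -> \bar R) (rho : R -> probability X R).
Hypothesis G0 : forall mu, Pp dist p mu -> (0 <= G mu)%E.
Hypothesis rho_slope : max_slope_curve dist p E G rho.

Lemma max_slope_curve_Pp t : 0 <= t -> Pp dist p (rho t).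
Proof.
move=> t0; have [AC _] := rho_slope.
have [|P _] := AC (t + 1); first by rewrite ltr_wpDl.
by apply: P; rewrite t0/= lerDl.
Qed.

(* The energy dissipated on [[t, t + 2]] tends to [0], and it controls both
   the length of the curve and the slope [G] on [[t, t + 1]]. *)
Lemma max_slope_curve_dissipation (c : R) :
  (forall t, 0 <= t -> (c%:E <= E (rho t))%E) ->
  exists C : R, forall e, 0 < e -> exists T, forall t, T <= t -> 0 <= t ->
    exists s, [/\ t <= s, W (rho t) (rho s) <= e, (G (rho s) <= e%:E)%E &
      (E (rho s) <= C%:E)%E].
Proof.
move=> cE; have [AC [phi [phi_ni phiE phi']]] := rho_slope.
have aeF := ae_filter_ringOfSetsType leb.
(* The energy bound does not depend on [e], so one sublevel set serves the compactness argument. *)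
exists (phi 0) => e e0.
(* Constant extension to negative times gives monotonicity on the whole line. *)
pose f x := phi (Num.max 0 x).
have fni : {homo f : s t /~ t <= s}.
  move=> s t st; apply: phi_ni.
  - by rewrite in_itv/= andbT le_max lexx.
  - by rewrite in_itv/= andbT le_max lexx.
  - by rewrite ge_max !le_max lexx/= st orbT.
have fE x : 0 <= x -> f x = phi x by move=> x0; rewrite /f max_r.
have ae_itv (P : R -> Prop) a b : a < b -> {ae leb, forall t, P t} ->
    exists2 s, a < s < b & P s.
  move=> ab aeP; apply: contrapT => nP.
  have : {ae leb, forall t, t \in `]a, b[ -> False}.
    apply: filterS aeP => t Pt; rewrite in_itv/= => tab; apply: nP.
    by exists t.
  move=> [N [mN N0 subN]]; have : (leb `]a, b[ <= leb N)%E.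
    apply: le_measure; rewrite ?inE// => x/= xab; apply: subN => /= h.
    exact: (h xab).
  by rewrite N0 lebesgue_measure_itv/= lte_fin ab -EFinB lee_fin leNgt subr_gt0 ab.
(* [E] and [phi] agree only almost everywhere: compare at a later time [s] where they do, then use
   monotonicity. *)
have cf x : c <= f x.
  have [s /andP[ms _] /(_ _)Es] := ae_itv _ (Num.max 0 x) (Num.max 0 x + 1)
    (ltr_pwDr ltr01 (lexx _)) phiE.
  have s0 : 0 <= s by rewrite (le_trans _ (ltW ms))// le_max lexx.
  have xs : x <= s by rewrite (le_trans _ (ltW ms))// le_max lexx orbT.
  rewrite -lee_fin (le_trans (cE s s0))// Es ?in_itv/= ?s0//.
  by rewrite lee_fin -fE// fni.
have [psi [mpsi psi0 psi_int psiE]] := ni_derivative_integral_le fni.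
have ae_psi : {ae leb, forall x, 0 < x -> exists g, [/\ G (rho x) = g%:E,
    0 <= g, E (rho x) = (phi x)%:E &
    psi x = (p^-1 * metric_deriv dist p rho x `^ p + q^-1 * g `^ q)%:E]}.
  apply: filterS2 phiE phi' => x xE x' x0.
  have x0' : x \in `[0, +oo[ by rewrite in_itv/= (ltW x0).
  have [dx dE] := x' x0'.
  have fphi : {near x, phi =1 f}.
    have := lt_nbhsr x0; apply: filterS => y y0.
    by rewrite fE// ltW.
  have df : derivable f x 1 by apply: near_eq_derivable dx => //; exact: oner_neq0.
  have dfE : derive1 f x = derive1 phi x.
    by rewrite !derive1E; apply/esym; exact: near_eq_derive fphi.
  have [g Gg [g0 dg]] := dissipation_fin (G0 (max_slope_curve_Pp (ltW x0))) dE.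
  exists g; split => //; first exact: xE.
  by rewrite psiE// dfE dg.
(* Since [psi] is at least [p^-1 * v ^ p], [le_add_powR] gives [v <= k + K * psi]. Then [eta]
   ensures [K * eta <= e / 2], and that [psi] cannot stay above [q^-1 * e ^ q] on a unit
   interval. *)
pose k := e / 2; pose K := k `^ (1 - p) * p.
have k0 : 0 < k by rewrite divr_gt0.
have K0 : 0 < K by rewrite mulr_gt0 ?powR_gt0.
pose eta := Num.min (e / 2 / K) (q^-1 * e `^ q).
have eta0 : 0 < eta.
  by rewrite lt_min !divr_gt0//= mulr_gt0 ?powR_gt0 ?invr_gt0.
have lbf : has_lbound (range f) by exists c => _ [x _ <-].
(* [f T] is taken within [eta] of the infimum of [f], so no later drop reaches [eta]. *)
have [T fT] : exists T, forall t, T <= t -> f t - f (t + 1 + 1) < eta.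
  have [|_ [T _ <-] Teta] := @inf_adherent _ (range f) _ eta0.
    by split => //; exists (f 0), 0.
  exists T => t Tt; have := fni T t Tt.
  have : inf (range f) <= f (t + 1 + 1) by apply: ge_inf => //; exists (t + 1 + 1).
  lra.
exists T => t Tt t0; have {}fT := fT t Tt.
have t01 : t <= t + 1 by rewrite lerDl.
(* With horizon [t + 2], all of []t, t + 1]] is interior and [v] is the metric derivative almost
   everywhere on it. *)
have t2 : 0 < t + 2 by lra.
have [v [iv v0 Wv dv]] := AC_metric_derivative Pd p1 t2 (AC _ t2).
have psi_sub (A : set R) : measurable A -> A `<=` `[t, t + 1] ->
    (\int[leb]_(x in A) psi x <= (f t - f (t + 1 + 1))%:E)%E.
  move=> mA sub; apply: le_trans (psi_int _ _ t01).
  by apply: ge0_subset_integral => //; exact: measurable_funTS.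
have oc_cc : `]t, t + 1] `<=` `[t, t + 1].
  by apply: subset_itv; rewrite bnd_simp.
have intc (a : \bar R) : (\int[leb]_(x in `]t, (t + 1)%R]) cst a x = a)%E.
  rewrite integral_cst//= lebesgue_measure_itv/= lte_fin ltrDl ltr01 -EFinB.
  by rewrite addrAC subrr add0r mule1.
have [s [/andP[ts s1] [g [Gg g0 Es _]] ge]] : exists s, [/\ t < s <= t + 1,
    exists g, [/\ G (rho s) = g%:E, 0 <= g, E (rho s) = (phi s)%:E &
      psi s = (p^-1 * metric_deriv dist p rho s `^ p + q^-1 * g `^ q)%:E] &
    (G (rho s) <= e%:E)%E].
  (* Otherwise [G > e] at almost every time of a unit interval, and [psi] would integrate to at
     least [q^-1 * e ^ q >= eta]. *)
  apply: contrapT => nP.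
  have : (\int[leb]_(x in `]t, (t + 1)%R]) (cst (q^-1 * e `^ q)%:E x) <=
      \int[leb]_(x in `]t, (t + 1)%R]) psi x)%E.
    apply: ae_ge0_le_integral => //.
    - by move=> x _; rewrite lee_fin mulr_ge0 ?powR_ge0// invr_ge0 ltW.
    - exact: measurable_funTS.
    - apply: filterS ae_psi => x xpsi; rewrite /= in_itv/= => tx.
      have [|g [Gg g0 Ex psix]] := xpsi; first by lra.
      have ge : e < g.
        rewrite ltNge; apply/negP => ge; apply: nP; exists x; split => //.
          by exists g.
        by rewrite Gg lee_fin.
      rewrite psix lee_fin.
      have eg : q^-1 * e `^ q <= q^-1 * g `^ q.
        rewrite ler_pM2l ?invr_gt0//.
        by apply: ge0_ler_powR; rewrite ?nnegrE ?(ltW q_gt0) ?(ltW e0) ?(ltW ge).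
      by apply: (le_trans eg); rewrite lerDr mulr_ge0 ?powR_ge0// invr_ge0 ltW.
  rewrite intc => h.
  have := le_trans h (psi_sub _ (measurable_itv _) oc_cc).
  rewrite lee_fin => {}h; have : eta <= q^-1 * e `^ q by rewrite /eta ge_min lexx orbT.
  by move: h fT; lra.
exists s; split; [exact: ltW| |exact: ge|].
  apply: le_trans (Wv _ _ t0 (ltW ts) _) _; first by lra.
  rewrite -lee_fin EFin_primitiveB ?(ltW ts)//.
  have mv : measurable_fun setT (EFin \o v) by exact: (measurable_int leb).
  apply: (@le_trans _ _ (\int[leb]_(x in `]t, (t + 1)%R]) (v x)%:E)%E).
    apply: ge0_subset_integral => //.
    - exact: measurable_funTS.
    - by move=> x _; rewrite lee_fin.
    - by move=> x /=; rewrite !in_itv/=; lra.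
  apply: (@le_trans _ _ (\int[leb]_(x in `]t, (t + 1)%R])
      (cst k%:E x + K%:E * psi x))%E).
    apply: ae_ge0_le_integral => //.
    - by move=> x _; rewrite lee_fin.
    - exact: measurable_funTS.
    - by move=> x _; rewrite adde_ge0 ?mule_ge0 ?lee_fin// ltW.
    - apply: emeasurable_funD => //; apply: emeasurable_funM => //.
      exact: measurable_funTS.
    - apply: filterS2 ae_psi dv => x xpsi xv; rewrite /= in_itv/= => /andP[tx x1].
      have [|g' [_ g'0 _ ->]] := xpsi _; first by lra.
      rewrite xv; last by lra.
      rewrite -EFinM -EFinD lee_fin (le_trans (le_add_powR k0 (v0 x)))// lerD2l.
      rewrite /K -mulrA ler_pM2l ?powR_gt0// mulrDr mulVKf ?gt_eqF// lerDl.
      by rewrite !mulr_ge0 ?powR_ge0 ?invr_ge0 ?(ltW q_gt0) ?(ltW p_gt0).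
  rewrite ge0_integralD//=; last 3 first.
  - by move=> x _; rewrite lee_fin ltW.
  - by move=> x _; rewrite mule_ge0// lee_fin ltW.
  - by apply: emeasurable_funM => //; exact: measurable_funTS.
  rewrite intc ge0_integralZl//; last 2 first.
  - exact: measurable_funTS.
  - by rewrite lee_fin ltW.
  apply: (@le_trans _ _ (k%:E + K%:E * eta%:E)%E).
    rewrite leeD2l// lee_wpmul2l ?lee_fin ?(ltW K0)//.
    apply: le_trans (psi_sub _ (measurable_itv _) oc_cc) _.
    by rewrite lee_fin ltW.
  rewrite -EFinM -EFinD lee_fin.
  have : K * eta <= e / 2.
    by rewrite mulrC -ler_pdivlMr// /eta ge_min lexx.
  by rewrite /k; lra.
rewrite Es lee_fin; apply: phi_ni; rewrite ?in_itv/= ?andbT; lra.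
Qed.

End dissipation.

Section convergence.
Context {R : realType}.

Lemma ge0_cvge_to0 (f : R -> \bar R) : (forall t, (0 <= f t)%E) ->
  (forall e, 0 < e -> exists T, forall t, T <= t -> (f t <= e%:E)%E) ->
  f t @[t --> +oo] --> 0%E.
Proof.
move=> f0 fe; apply/fine_cvgP; split.
  have [T fT] := fe 1 ltr01; near=> t.
  have Tt : T <= t by near: t; apply: nbhs_pinfty_ge; exact: num_real.
  by rewrite ge0_fin_numE// (le_lt_trans (fT t Tt))// ltry.
apply/cvgrPdist_le => e e0; have [T fT] := fe e e0; near=> t.
have Tt : T <= t by near: t; apply: nbhs_pinfty_ge; exact: num_real.
rewrite sub0r normrN /= ger0_norm ?fine_ge0//.
by have := fT t Tt; have := f0 t; case: (f t).
Unshelve. all: by end_near. Qed.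

Lemma increasing_ge_id (f : nat -> nat) : (forall n, (f n < f n.+1)%N) ->
  forall n, (n <= f n)%N.
Proof. by move=> ff; elim=> // n; move/leq_ltn_trans; apply. Qed.

Context {dX : measure_display} {X : measurableType dX}.
Context {dist : X -> X -> R} (Pd : polish_borel dist) {p : R} (p1 : 1 < p).
Context (E G Et Gt : probability X R -> \bar R).
Hypotheses (G0 : forall mu, Pp dist p mu -> (0 <= G mu)%E)
  (EtE : forall mu, Pp dist p mu -> Et mu = E mu)
  (GtG : forall mu, Pp dist p mu -> Gt mu = G mu)
  (Gt0 : forall mu, (0 <= Gt mu)%E).
Hypotheses (hB1 : B1 dist Et) (hB3 : B3 dist Gt).
Context (rho : R -> probability X R).
Hypothesis rho_slope : max_slope_curve dist p E G rho.

(* [L] collects the limits of sequences of [K]: it is the whole space for the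
   first claim of the theorem, and [K] itself when [K] is closed. *)
Lemma dLP_set_cvg0 (K L : set (probability X R)) :
  (forall t, 0 <= t -> K (rho t)) ->
  (forall C : R, LP_rel_compact dist
    [set mu | Pp dist p mu /\ K mu /\ (E mu <= C%:E)%E]) ->
  (forall u mu, (forall n, K (u n)) -> LP_cvg dist u mu -> L mu) ->
  dLP_set dist (rho t) (weak_stationary Et Gt `&` L) @[t --> +oo] --> 0%E.
Proof.
move=> Krho Kcpt KL; apply: ge0_cvge_to0 => [t|e e0].
  by apply: le_ereal_inf_tmp => _ [mu _ <-]; rewrite lee_fin dLP_ge0.
suff [T rhoT] : exists T, forall t, T <= t -> exists2 mu,
    (weak_stationary Et Gt `&` L) mu & dLP dist (rho t) mu <= e.
  exists T => t /rhoT[mu smu mue]; apply: (@le_trans _ _ (dLP dist (rho t) mu)%:E).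
    by apply: ereal_inf_lbound; exists mu.
  by rewrite lee_fin.
have [_ _ [c cEt] Et_lsc] := hB1.
have Prho := max_slope_curve_Pp rho_slope.
have [|C disC] := max_slope_curve_dissipation Pd p1 G0 rho_slope (c := c).
  by move=> t t0; rewrite -EtE ?cEt//; exact: Prho.
apply: contrapT => /forallNP nT.
(* A counterexample gives times [t] whose measure stays [e] away from the target set, each with a
   companion [s] of small slope and bounded energy. Compactness is applied at [s], the contradiction
   occurs at [t]. *)
have /choice[ts tsP] : forall n : nat, exists ts : R * R, [/\ 0 <= ts.1, 0 <= ts.2,
    (forall mu, (weak_stationary Et Gt `&` L) mu -> e < dLP dist (rho ts.1) mu) &
    [/\ Wp dist p (rho ts.1) (rho ts.2) <= n.+1%:R^-1,
      (G (rho ts.2) <= n.+1%:R^-1%:E)%E & (E (rho ts.2) <= C%:E)%E]].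
  move=> n; have [|T TP] := disC n.+1%:R^-1; first by rewrite invr_gt0.
  have /existsNP[t /not_implyP[Tt nt]] := nT (Num.max 0 T).
  move: Tt; rewrite ge_max => /andP[t0 Tt].
  have [s [ts Ws Gs Es]] := TP t Tt t0.
  exists (t, s); split => //=; first exact: le_trans ts.
  move=> mu smu; rewrite ltNge; apply/negP => mue; apply: nt.
  by exists mu.
have [|f [mu [f_incr umu]]] := Kcpt C (fun n => rho (ts n).2).
  move=> n; have [t0 s0 _ [_ _ Es]] := tsP n.
  by split; [exact: Prho|split => //; exact: Krho].
have fge := increasing_ge_id f_incr.
have Lmu : L mu.
  by apply: (KL _ _ _ umu) => n /=; apply: Krho; have [] := tsP (f n).
have smu : weak_stationary Et Gt mu.
  split.
    apply: (@le_lt_trans _ _ C%:E); last by rewrite ltry.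
    apply: (le_trans (Et_lsc _ _ umu)); apply: limn_einf_le; apply: nearW => n /=.
    by have [_ s0 _ [_ _]] := tsP (f n); rewrite EtE//; exact: Prho.
  apply/eqP; rewrite eq_le Gt0 andbT; apply/lee_addgt0Pr => d d0; rewrite add0e.
  apply: (le_trans (hB3 umu)); apply: limn_einf_le.
  near=> n; have [_ s0 _ [_ Gs _]] := tsP (f n).
  rewrite /= GtG; last exact: Prho.
  rewrite (le_trans Gs)// lee_fin (@le_trans _ _ n.+1%:R^-1)//.
    by rewrite lef_pV2 ?posrE// ler_nat ltnS fge.
  by rewrite ltW//; near: n; exact: near_infty_natSinv_lt (PosNum d0).
have e2 : 0 < e / 2 by rewrite divr_gt0.
(* This is the threshold of [dLP_le_Wp] for the radius [e / 2]; the other half is spent between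
   [rho s] and the limit. *)
have a0 : 0 < e / 2 * (e / 2) `^ p^-1 by rewrite mulr_gt0// powR_gt0.
have : \forall n \near \oo, dLP dist (rho (ts (f n)).2) mu < e / 2.
  move/cvgrPdist_lt : umu => /(_ _ e2); apply: filterS => n.
  by rewrite sub0r normrN /= ger0_norm// dLP_ge0.
have : \forall n \near \oo, n.+1%:R^-1 < e / 2 * (e / 2) `^ p^-1 :> R.
  exact: near_infty_natSinv_lt (PosNum a0).
move=> near1 near2; near \oo => n.
have na : n.+1%:R^-1 < e / 2 * (e / 2) `^ p^-1 :> R by near: n.
have nd : dLP dist (rho (ts (f n)).2) mu < e / 2 by near: n.
have [t0 s0 far [Ws _ _]] := tsP (f n).
have := far mu (conj smu Lmu); rewrite ltNge => /negP; apply.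
apply: (le_trans (dLP_triangle Pd (rho (ts (f n)).2) _ _)).
have : dLP dist (rho (ts (f n)).1) (rho (ts (f n)).2) <= e / 2.
  apply: (dLP_le_Wp Pd p1 (Prho _ t0) (Prho _ s0) e2).
  apply: le_lt_trans na; rewrite (le_trans Ws)//.
  by rewrite lef_pV2 ?posrE// ler_nat ltnS fge.
by move: nd; lra.
Unshelve. all: by end_near. Qed.

End convergence.

Theorem theorem2p17 (R : realType) (dX : measure_display) (X : measurableType dX)
  (dist : X -> X -> R) (p : R)
  (E G Et Gt : @PX R dX X -> \bar R) :
  polish_borel dist ->
  1 < p ->
  (* E : P_p(X) -> (-oo,+oo] proper *)
  (forall mu, Pp dist p mu -> E mu != -oo%E) ->
  (exists mu, Pp dist p mu /\ (E mu < +oo)%E) ->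
  (* G : P_p(X) -> [0,+oo] weak upper gradient for E *)
  (forall mu, Pp dist p mu -> (0 <= G mu)%E) ->
  weak_upper_gradient dist p E G ->
  (* extensions *)
  (forall mu, Pp dist p mu -> Et mu = E mu) ->
  (forall mu, Pp dist p mu -> Gt mu = G mu) ->
  (forall mu, (0 <= Gt mu)%E) ->
  B1 dist Et -> B3 dist Gt ->
  (* existence of curves of maximal slope *)
  (forall rho0, Z_Ep dist p E rho0 ->
     exists rho, max_slope_curve dist p E G rho /\ rho 0 = rho0) ->
  forall rho : R -> PX,
    max_slope_curve dist p E G rho -> Z_Ep dist p E (rho 0) ->
    (B2 dist Et \/ exists Y, B2' dist p E rho Y) ->
    (dLP_set dist (rho t) (weak_stationary Et Gt) @[t --> +oo] --> 0%E) /\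
    (forall Y, B2' dist p E rho Y -> LP_closed dist Y ->
       dLP_set dist (rho t) (weak_stationary Et Gt `&` Y) @[t --> +oo] --> 0%E).
Proof.
move=> Pd p1 _ _ G0 _ EtE GtG Gt0 hB1 hB3 _ rho rho_slope _ cpt; split.
  have [K [Krho Kcpt]] : exists K : set (probability X R),
      (forall t, 0 <= t -> K (rho t)) /\
      (forall C : R, LP_rel_compact dist
         [set mu | Pp dist p mu /\ K mu /\ (E mu <= C%:E)%E]).
    case: cpt => [hB2|[Y [Yrho Ycpt]]]; last by exists Y.
    exists setT; split => // C u uP; apply: (hB2 C) => n /=.
    by have [Pu [_ Eu]] := uP n; rewrite EtE.
  rewrite -(setIT (weak_stationary Et Gt)).
  exact: (dLP_set_cvg0 Pd p1 G0 EtE GtG Gt0 hB1 hB3 rho_slope Krho Kcpt).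
move=> Y [Yrho Ycpt] cY.
by apply: (dLP_set_cvg0 Pd p1 G0 EtE GtG Gt0 hB1 hB3 rho_slope Yrho Ycpt).
Qed.
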